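(* Let $\mathcal P$ and $\mathcal Q$ be nonempty families of probability measures on a measurable space $(\Omega,\mathcal F)$, all absolutely continuous with respect to a reference probability measure $R$ on $(\Omega,\mathcal F)$, satisfying the joint measurability convention of the context. Assume that (i) $\mathfrak Z_{\mathcal Q}$ is a weakly compact, convex subset of $\mathbb L^1(\Omega,\mathcal F,R)$, and (ii) $\mathfrak Z_{\mathcal P}$ is a weakly compact subset of $\mathbb L^1(\Omega,\mathcal F,R)$. Let $\alpha\in(0,1)$. Then there exist a randomized test $\widetilde\varphi\in\Phi_\alpha$ which attains the supremum $$\sup_{\varphi\in\Phi_\alpha}\Bigl(\inf_{Q\in\mathcal Q}\mathbb E^Q[\varphi]\Bigr),$$ and a pair $(\widetilde Q,\widetilde\lambda)\in\mathcal Q\times\Lambda_+$ which attains the infimum $$\inf_{Q\in\mathcal Q,\ \lambda\in\Lambda_+}\mathcal D(Q,\lambda),$$ such that: (a) for $R$-a.e. $\omega\in\Omega$, $$\widetilde\varphi(\omega)=\begin{cases}1,&\text{if } Z_{\widetilde Q}(\omega)>\int_{\mathfrak Z_{\mathcal P}}Z_P(\omega)\,\mathrm d\widetilde\lambda,\\[2pt] 0,&\text{if } Z_{\widetilde Q}(\omega)<\int_{\mathfrak Z_{\mathcal P}}Z_P(\omega)\,\mathrm d\widetilde\lambda,\end{cases}$$ and $\mathbb E^R[\widetilde\varphi\, Z_P]=\alpha$ for $\widetilde\lambda$-a.e. $Z_P\in\mathfrak Z_{\mathcal P}$; (b) $(\widetilde\varphi,\widetilde Q)$ is a saddlepoint in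 $\Phi_\alpha\times\mathcal Q$ of the functional $(\varphi,Q)\mapsto\mathbb E^Q[\varphi]$, that is, $$\mathbb E^{\widetilde Q}[\varphi]\le\mathbb E^{\widetilde Q}[\widetilde\varphi]\le\mathbb E^{Q}[\widetilde\varphi]\qquad\text{for all }(\varphi,Q)\in\Phi_\alpha\times\mathcal Q.$$
   Context: For a finite measure $\Pi\ll R$ write $Z_\Pi=\mathrm d\Pi/\mathrm dR$ and $\mathbb E^\Pi[Y]=\int_\Omega Y\,\mathrm d\Pi=\int_\Omega Z_\Pi Y\,\mathrm dR$. Set $\mathfrak Z_{\mathcal P}=\{Z_P: P\in\mathcal P\}$ and $\mathfrak Z_{\mathcal Q}=\{Z_Q:Q\in\mathcal Q\}$, viewed as subsets of $\mathbb L^1=\mathbb L^1(\Omega,\mathcal F,R)$; ''weakly'' refers to the weak topology of $\mathbb L^1$. Let $\mathcal B$ be the $\sigma$-algebra of Borel subsets of $\mathfrak Z_{\mathcal P}$ (for the weak topology). Joint measurability convention: for the elements of $\mathfrak Z_{\mathcal P}$ versions (with values in $[0,\infty)$) are fixed such that the map $\Omega\times\mathfrak Z_{\mathcal P}\ni(\omega,Z)\mapsto Z(\omega)\in[0,\infty)$ is measurable with respect to $\mathcal F\otimes\mathcal B$. $\Phi$ is the set of randomized tests, i.e. measurable functions $\varphi:\Omega\to[0,1]$ on $(\Omega,\mathcal F)$, and $\Phi_\alpha=\{\varphi\in\Phi:\sup_{P\in\mathcal P}\mathbb E^P[\varphi]\le\alpha\}$. $\Lambda_+$ is the set of finite (nonnegative)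 measures on $(\mathfrak Z_{\mathcal P},\mathcal B)$. For $\lambda\in\Lambda_+$ and $\omega\in\Omega$, $\int_{\mathfrak Z_{\mathcal P}}Z_P(\omega)\,\mathrm d\lambda$ denotes the integral with respect to $\lambda$ of the function $Z\mapsto Z(\omega)$ on $\mathfrak Z_{\mathcal P}$. For $Q\in\mathcal Q$, $\lambda\in\Lambda_+$, $$\mathcal D(Q,\lambda)=\mathbb E^R\Bigl[\Bigl(Z_Q-\int_{\mathfrak Z_{\mathcal P}}Z_P\,\mathrm d\lambda\Bigr)^+\Bigr]+\alpha\,\lambda(\mathfrak Z_{\mathcal P}).$$ *)

(* Defs.v *)
From HB Require Import structures.
From mathcomp Require Import all_boot all_order all_algebra.
From mathcomp Require Import all_classical all_reals all_analysis.
From mathcomp Require Import measurable_realfun.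

Set Implicit Arguments.
Unset Strict Implicit.
Unset Printing Implicit Defensive.
Import Order.TTheory GRing.Theory Num.Theory.
Import numFieldNormedType.Exports.

Local Open Scope classical_set_scope.
Local Open Scope ring_scope.

Section L1_class.
Context d (T : measurableType d) (R : realType).
Variable mu : {measure set T -> \bar R}.

Local Notation Lfun1 := (LfunType mu (@lexx _ _ 1%E)).
Local Notation L1 := (LspaceType1 mu).
Local Notation Q := {mfun_ mu, T >-> measurableTypeR R}.

Lemma ae_eq_Lnorm1 (f g : T -> R) : measurable_fun setT f ->
  measurable_fun setT g -> f = g %[ae mu] ->
  ('N[mu]_1[EFin \o f] = 'N[mu]_1[EFin \o g])%E.
Proof.
move=> mf mg fg; rewrite !Lnorm1; apply: ae_eq_integral => //=.
- by apply/measurable_EFinP; exact: measurableT_comp.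
- by apply/measurable_EFinP; exact: measurableT_comp.
- by apply: filterS fg => x /= fgx xT; rewrite fgx.
Qed.

Section class_of.
Variable f : Lfun1.

Let f' : T -> measurableTypeR R := f.
Let mf' : measurable_fun setT f'.
Proof.
by move=> ? Y mY; exact: (@measurable_funPT _ _ _ _ f measurableT Y mY).
Qed.
HB.instance Definition _ :=
  @isMeasurableFun.Build _ _ T (measurableTypeR R) f' mf'.

Let piQ : Q := (\pi_Q (f' : {mfun T >-> measurableTypeR R}))%qT.

Let piQE : (piQ : T -> R) = f %[ae mu].
Proof.
have /eqP : (\pi_Q (repr piQ) = \pi_Q (f' : {mfun T >-> measurableTypeR R}))%qT.
  by rewrite reprK.
by rewrite eqmodE => /asboolP.
Qed.

Let piQ_fin : finite_norm mu 1 piQ.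
Proof.
rewrite /finite_norm (@ae_eq_Lnorm1 piQ f) //; first exact: Lfunction_finite.
move=> ? Y mY.
exact: (@measurable_funPT _ _ _ _ (repr piQ) measurableT Y mY).
Qed.

HB.instance Definition _ :=
  isFinLebesgue.Build d T R mu 1%E (lexx 1%E) piQ piQ_fin.

Definition L1_class : L1 := piQ.

Lemma L1_classE : (L1_class : T -> R) = f %[ae mu].
Proof. exact: piQE. Qed.

End class_of.

Section repr_of.
Variable u : L1.
Let f : T -> R := u.
Let mf : measurable_fun setT f.
Proof.
move=> ? Y mY.
exact: (@measurable_funPT _ _ _ _ (repr (u : Q)) measurableT Y mY).
Qed.
HB.instance Definition _ := isMeasurableFun.Build _ _ T R f mf.
Let finf : finite_norm mu 1 f. Proof. exact: Lebesgue_finite. Qed.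
HB.instance Definition _ := isLfunction.Build d T R mu 1%E (lexx 1%E) f finf.
Definition L1_repr : Lfun1 := f.
Lemma L1_reprE : (L1_repr : T -> R) = u. Proof. by []. Qed.
End repr_of.

Lemma L1_eqP (u v : L1) : u = v <-> (u : T -> R) = v %[ae mu].
Proof.
split=> [->|]; first exact: ae_eq_refl.
case: u v => [u [[pu]]] [v [[pv]]] /= uv.
have uvE : u = v.
  by rewrite -[u]reprK -[v]reprK; apply/eqmodP/asboolP.
by subst v; rewrite (Prop_irrelevance pu pv).
Qed.

Lemma L1_class_eqP (f g : Lfun1) :
  L1_class f = L1_class g <-> (f : T -> R) = g %[ae mu].
Proof.
rewrite L1_eqP; split=> fg.
  exact: ae_eq_trans (ae_eq_sym (L1_classE f)) (ae_eq_trans fg (L1_classE g)).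
exact: ae_eq_trans (L1_classE f) (ae_eq_trans fg (ae_eq_sym (L1_classE g))).
Qed.

Lemma L1_reprK : cancel (@L1_repr) L1_class.
Proof. by move=> u; apply/L1_eqP; exact: L1_classE. Qed.

End L1_class.

(* The library provides the carrier of L^1 (classes of a.e. equal functions) but
   no structure on it; the operations and the norm are those of
   representatives. *)
Section L1_normed.
Context d (T : measurableType d) (R : realType).
Variable mu : {measure set T -> \bar R}.

Local Notation Lfun1 := (LfunType mu (@lexx _ _ 1%E)).
Local Notation L1 := (LspaceType1 mu).
Local Notation cl := (@L1_class _ _ _ mu).
Local Notation r := (@L1_repr _ _ _ mu).
Implicit Types (u v w : L1) (a b : R) (f g : Lfun1).

HB.instance Definition _ := gen_eqMixin L1.
HB.instance Definition _ := gen_choiceMixin L1.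

Definition L1_zero : L1 := cl 0.
Definition L1_opp u : L1 := cl (- r u).
Definition L1_add u v : L1 := cl (r u + r v).
Definition L1_scale a u : L1 := cl (a *: r u).

Lemma L1_reprK_ae f : (r (cl f) : T -> R) = f %[ae mu].
Proof. exact: L1_classE. Qed.

Lemma L1_class_add f g : L1_add (cl f) (cl g) = cl (f + g).
Proof.
apply/L1_class_eqP; move: (L1_reprK_ae f) (L1_reprK_ae g).
by apply: filterS2 => x fx gx xT; exact: (f_equal2 +%R (fx xT) (gx xT)).
Qed.

Lemma L1_class_opp f : L1_opp (cl f) = cl (- f).
Proof.
apply/L1_class_eqP; move: (L1_reprK_ae f).
by apply: filterS => x fx xT; exact: (f_equal -%R (fx xT)).
Qed.

Lemma L1_class_scale a f : L1_scale a (cl f) = cl (a *: f).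
Proof.
apply/L1_class_eqP; move: (L1_reprK_ae f).
by apply: filterS => x fx xT; exact: (f_equal ( *%R a) (fx xT)).
Qed.

Let L1_ind (P : L1 -> Prop) : (forall f, P (cl f)) -> forall u, P u.
Proof. by move=> Pf u; rewrite -(L1_reprK u). Qed.

Let L1E := (L1_class_add, L1_class_opp, L1_class_scale).

Let L1_addA : associative L1_add.
Proof.
by elim/L1_ind=> f; elim/L1_ind=> g; elim/L1_ind=> h; rewrite !L1E addrA.
Qed.

Let L1_addC : commutative L1_add.
Proof. by elim/L1_ind=> f; elim/L1_ind=> g; rewrite !L1E addrC. Qed.

Let L1_add0 : left_id L1_zero L1_add.
Proof. by elim/L1_ind=> f; rewrite !L1E add0r. Qed.

Let L1_addN : left_inverse L1_zero L1_opp L1_add.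
Proof. by elim/L1_ind=> f; rewrite !L1E addNr. Qed.

HB.instance Definition _ :=
  GRing.isZmodule.Build L1 L1_addA L1_addC L1_add0 L1_addN.

Let L1_scaleA a b u : L1_scale a (L1_scale b u) = L1_scale (a * b) u.
Proof. by elim/L1_ind: u => f; rewrite !L1E scalerA. Qed.

Let L1_scale1 : left_id 1 L1_scale.
Proof. by elim/L1_ind=> f; rewrite !L1E scale1r. Qed.

Let L1_scaleDr : right_distributive L1_scale +%R.
Proof.
move=> a; elim/L1_ind=> f; elim/L1_ind=> g.
by rewrite /GRing.add/= !L1E scalerDr.
Qed.

Let L1_scaleDl u : {morph L1_scale^~ u : a b / a + b}.
Proof.
elim/L1_ind: u => f a b; rewrite [in RHS]/GRing.add/= !L1E; congr L1_class.
by rewrite scalerDl.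
Qed.

HB.instance Definition _ := GRing.Zmodule_isLmodule.Build R L1
  L1_scaleA L1_scale1 L1_scaleDr L1_scaleDl.

Definition L1_norm u : R := fine ('N[mu]_1[EFin \o u])%E.

Let L1_norm_class f : L1_norm (cl f) = fine ('N[mu]_1[EFin \o f])%E.
Proof. by congr fine; apply: ae_eq_Lnorm1 => //; exact: L1_classE. Qed.

Let L1_ler_normD u v : L1_norm (u + v) <= L1_norm u + L1_norm v.
Proof.
elim/L1_ind: u => f; elim/L1_ind: v => g.
rewrite [_ + _]L1_class_add !L1_norm_class; exact: ler_LnormD.
Qed.

Let L1_normrZ a u : L1_norm (a *: u) = `|a| * L1_norm u.
Proof.
elim/L1_ind: u => f; rewrite [_ *: _]L1_class_scale !L1_norm_class.
by apply: EFin_inj; rewrite EFinM !finite_norm_fine LnormZ.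
Qed.

Let L1_normr0_eq0 u : L1_norm u = 0 -> u = 0.
Proof.
elim/L1_ind: u => f; rewrite L1_norm_class => /fine_Lnormr_eq0 f0.
exact/L1_class_eqP.
Qed.

HB.instance Definition _ := Lmodule_isNormed.Build R L1
  L1_ler_normD L1_normrZ L1_normr0_eq0.

End L1_normed.

(* Initial topology of V for all its norm-continuous linear functionals. *)
Section weak_topology.
Context (R : realType) (V : normedModType R).

Definition continuous_dual := {f : {linear V -> R^o} | continuous f}.

Definition weak : Type :=
  sup_topology (fun f : continuous_dual =>
    Topological.on (initial_topology (sval f))).

HB.instance Definition _ := Topological.on weak.

Definition weakly_compact (A : set V) := compact (A : set weak).

End weak_topology.
Arguments weak {R} V.

Section borel_subset.
Context (X : topologicalType) (A : set X).

(* The subspace A as a type. The structure of measurable type requires a point,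
   hence the proof of nonemptiness as a phantom parameter. *)
Definition pointed_subset (A0 : A !=set0) : Type := A.

HB.instance Definition _ A0 := Topological.copy (pointed_subset A0) A.
HB.instance Definition _ A0 := isPointed.Build (pointed_subset A0)
  (exist _ (sval (cid A0)) (mem_set (svalP (cid A0)))).

Definition borel_subset A0 := g_sigma_algebraType (@open (pointed_subset A0)).

End borel_subset.

Section testing.
Local Open Scope charge_scope.
Context d (T : measurableType d) (R : realType).
Variable mu : probability T R.
Implicit Types (p q : probability T R) (P Q : set (probability T R)).
Local Notation L1 := (LspaceType1 mu).

(* Class of f; 0 if f is not integrable. *)
Definition L1_of (f : T -> R) : L1 :=
  if pselect (f \in Lfun mu 1) is left f1 then L1_class (Lfun_Sub (lexx 1%E) f1)
  else 0.

Definition density p : L1 :=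
  L1_of (fine \o 'd (charge_of_finite_measure p) '/d mu).

Lemma L1_ofE (f : T -> R) : f \in Lfun mu 1 -> (L1_of f : T -> R) = f %[ae mu].
Proof.
by move=> f1; rewrite /L1_of; case: pselect => // f1'; exact: L1_classE.
Qed.

Lemma densityE p : p `<< mu ->
  (EFin \o density p : T -> \bar R) =
    'd (charge_of_finite_measure p) '/d mu %[ae mu].
Proof.
move=> pmu; set h := 'd _ '/d _.
have hfin w : h w \is a fin_num by exact: Radon_Nikodym_fin_num.
have hE : EFin \o (fine \o h) = h by apply/funext => w /=; rewrite fineK.
have : fine \o h \in Lfun mu 1.
  by apply/Lfun1_integrable; rewrite hE; exact: Radon_Nikodym_integrable.
move=> /L1_ofE; apply: filterS => w /= hw wT.
by rewrite [X in X%:E]hw// fineK.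
Qed.

Lemma integral_density p (A : set T) : p `<< mu -> measurable A ->
  p A = (\int[mu]_(w in A) (density p w)%:E)%E.
Proof.
move=> pmu mA.
rewrite -[LHS]/(charge_of_finite_measure p A).
rewrite (@Radon_Nikodym_integral _ _ _ (charge_of_finite_measure p) mu A)//.
have mh : measurable_fun setT ('d (charge_of_finite_measure p) '/d mu).
  by apply: (measurable_int mu); exact: Radon_Nikodym_integrable.
apply: ae_eq_integral => //.
- exact: measurable_funTS.
- apply/measurable_EFinP; apply: measurable_funTS.
  exact: (measurable_funPT (L1_repr (density p))).
- by apply: filterS (densityE pmu) => w /(_ I) /= -> .
Qed.

Definition densities P : set L1 := [set density p | p in P].

Lemma densities_neq0 P : P !=set0 -> densities P !=set0.
Proof. by case=> p Pp; exists (density p), p. Qed.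

Definition tests : set (T -> R) :=
  [set phi : T -> R | measurable_fun setT phi /\ forall w, 0 <= phi w <= 1].

Definition level_tests P (alpha : R) : set (T -> R) :=
  [set phi : T -> R | tests phi /\
    (ereal_sup [set 'E_p[phi] | p in P] <= alpha%:E)%E].

Definition worst_power Q (phi : T -> R) : \bar R :=
  ereal_inf [set 'E_q[phi]%E | q in Q].

Section dual_functional.
Context P (P0 : P !=set0).

Definition ZP := @borel_subset (weak L1) (densities P) (densities_neq0 P0).

Variable Z : ZP -> T -> R.

(* Z z w is the value at w of the version chosen for the class z. *)
Definition versions :=
  [/\ forall z w, 0 <= Z z w,
      forall z, Z z = (set_val z : L1) %[ae mu] &
      measurable_fun setT (fun wz : T * ZP => Z wz.2 wz.1)].

Definition mixture (la : {finite_measure set ZP -> \bar R}) (w : T) : \bar R :=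
  (\int[la]_z (Z z w)%:E)%E.

Definition dual_value (alpha : R) q la : \bar R :=
  (\int[mu]_w ((fun w => (density q w)%:E - mixture la w)^\+ w)
   + alpha%:E * la setT)%E.

End dual_functional.

End testing.
Arguments densities {d T R} mu P.

(* Main.v *)
(* The Lagrangian
     L(phi; q, la) = E^q[phi] + \int (alpha - E[phi Z]) dla(Z)
   is affine in the test phi and in the pair (q, la), and D(q, la) is its maximum
   over all tests. For each finite list of tests, regret matching gives an
   approximate saddle point of the game where la has mass at most c = 2 / alpha;
   there la is finitely supported and q is an average of elements of Q. An
   ultrafilter on the finite lists yields limits: of the tests by the
   Radon-Nikodym theorem, of the q by weak compactness, and of the la, as positive
   functionals on bounded functions, by a Riesz representation on the weakly
   compact space of densities of P. In the limit
     D(q~, la~) <= L(phi~; q, c delta_Z) and D(q~, la~) <= L(phi~; q, 0)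
   for all q and Z. The second inequality bounds the mass of la~ by 1 / alpha < c,
   so the first one forces phi~ to have level alpha; everything else is weak
   duality and its equality case. *)

From HB Require Import structures.
Require Import Defs.
From mathcomp Require Import all_boot all_order all_algebra.
From mathcomp Require Import all_classical all_reals all_analysis.
From mathcomp Require Import measurable_realfun ring lra.

Set Implicit Arguments.
Unset Strict Implicit.
Unset Printing Implicit Defensive.
Import Order.TTheory GRing.Theory Num.Theory.
Import numFieldNormedType.Exports.

Local Open Scope classical_set_scope.
Local Open Scope ring_scope.

(** * Approximate minimax *)

Section minimax.
Context (R : realType) (m : nat) (J : Type) (A : 'I_m.+1 -> J -> R) (C : R).
Hypothesis A_bounded : forall i j, `|A i j| <= C.

Local Notation pos x := (Num.max x 0).

(** The square of the positive part has derivative [2 * pos x], which is Lipschitz with constant 2.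
    This is the one-step estimate for the potential that regret matching controls. *)
Lemma posD_sqr_le (x r : R) :
  pos (x + r) ^+ 2 <= pos x ^+ 2 + 2 * pos x * r + r ^+ 2.
Proof.
have [h|h] := leP (x + r) 0; have [h'|h'] := leP x 0; nra.
Qed.

(** The set [J] of columns may be infinite, so a best reply need not exist. Boundedness of [A] makes
    the infimum finite, and the slack [e] pays for not attaining it. *)
Lemma almost_best_reply (j0 : J) (x : 'I_m.+1 -> R) (e : R) : 0 < e ->
  exists j, forall k, \sum_i x i * A i j <= \sum_i x i * A i k + e.
Proof.
move=> e0; pose V := range (fun j => \sum_i x i * A i j).
have Vinf : has_inf V.
  split; first by exists (\sum_i x i * A i j0), j0.
  exists (- \sum_i `|x i| * C) => _ [j _ <-].
  rewrite lerNl -sumrN; apply: ler_sum => i _.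
  rewrite -mulrN (le_trans (ler_norm _))// normrM normrN.
  by rewrite ler_wpM2l.
have [_ [j _ <-] jV] := inf_adherent e0 Vinf.
exists j => k; apply: ltW; apply: (lt_le_trans jV).
by rewrite lerD2r; apply: ge_inf => //; [exact: Vinf.2|exists k].
Qed.

(* Regret matching: [r i] is the regret of the row player for not having always
   played row [i]. Mixing the rows proportionally to the positive regrets makes
   the increment of the regrets orthogonal to their positive parts, so that the
   squared norm of the latter grows only linearly. *)
Lemma regret_matching (j0 : J) (e : R) (n : nat) : 0 < e ->
  exists (x : 'I_m.+1 -> R) (s : seq J) (r : 'I_m.+1 -> R),
    [/\ forall i, 0 <= x i, \sum_i x i = n%:R, size s = n,
        \sum_i pos (r i) ^+ 2 <= n%:R * (m.+1%:R * (2 * C) ^+ 2) &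
        forall i j, \sum_(k <- s) A i k - r i <=
          \sum_k x k * A k j + n%:R * e].
Proof.
move=> e0; elim: n => [|n [x [s [r [x0 x1 sn rn xs]]]]].
  exists (fun=> 0), [::], (fun=> 0); split => //.
  - by rewrite big1.
  - by rewrite mul0r big1// => i _; rewrite maxxx expr0n.
  - move=> i j; rewrite big_nil subr0 mul0r addr0 big1// => k _.
    by rewrite mul0r.
have C0 : 0 <= C by exact: le_trans (A_bounded ord0 j0).
have pos0 (y : R) : 0 <= pos y by rewrite le_max lexx orbT.
have [y [y0 y1 yr]] : exists y : 'I_m.+1 -> R,
    [/\ forall i, 0 <= y i, \sum_i y i = 1 &
        exists c, forall i, pos (r i) = c * y i].
  (* If no regret is positive, every mixed row is proportional to the zero vector with factor 0; row
     0 is taken. Otherwise the positive regrets are normalized. *)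
  have [S0|S0] := eqVneq (\sum_i pos (r i)) 0.
    exists (fun i => (i == ord0)%:R); split.
    - by move=> i; rewrite ler0n.
    - rewrite (bigD1 ord0)//= big1 ?addr0// => i /negbTE -> //.
    - exists 0 => i; rewrite mul0r; move/eqP: S0; rewrite psumr_eq0//.
      by move/allP => /(_ i (mem_index_enum _)) /eqP.
  exists (fun i => pos (r i) / \sum_i pos (r i)); split.
  - by move=> i; rewrite divr_ge0// sumr_ge0.
  - by rewrite -mulr_suml divff.
  - by exists (\sum_i pos (r i)) => i; rewrite mulrC divfK.
have [j jmin] := almost_best_reply j0 y e0.
set v := \sum_i y i * A i j in jmin.
have vC : `|v| <= C.
  rewrite (le_trans (ler_norm_sum _ _ _))//.
  rewrite -[leRHS]mul1r -y1 mulr_suml; apply: ler_sum => i _.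
  by rewrite normrM ger0_norm// ler_wpM2l.
exists (fun i => x i + y i), (j :: s), (fun i => r i + (A i j - v)); split.
- by move=> i; rewrite addr_ge0.
- by rewrite big_split/= x1 y1 -natr1.
- by rewrite /= sn.
- apply: (@le_trans _ _ (\sum_i (pos (r i) ^+ 2 + 2 * pos (r i) * (A i j - v) +
      (2 * C) ^+ 2))).
    apply: ler_sum => i _; apply: (le_trans (posD_sqr_le _ _)).
    rewrite lerD2l -[leLHS]real_normK ?num_real// lerXn2r ?nnegrE ?mulr_ge0//.
    by rewrite (le_trans (ler_normB _ _))// mulrDl mul1r lerD.
  rewrite !big_split/= sumr_const card_ord -[_ *+ m.+1]mulr_natl.
  have [c cy] := yr.
  rewrite [X in _ + X + _](_ : _ = 0).
    by rewrite addr0 -[n.+1%:R]natr1 [leRHS]mulrDl mul1r lerD2r.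
  (* The cross term vanishes because [v] is the [y]-average of column [j] and the positive regrets
     are multiples of [y]. *)
  transitivity (2 * c * (v - v * \sum_i y i)).
    rewrite mulr_sumr /v -sumrB mulr_sumr; apply: eq_bigr => i _.
    by rewrite cy; ring.
  by rewrite y1 mulr1 subrr mulr0.
(* Subtracting the regret of row [i] from its cumulative payoff leaves the payoff actually received,
   whatever [i] is. In each round that payoff exceeds the one against any fixed column [k] by at
   most [e]. *)
- move=> i k; rewrite big_cons -[n.+1%:R]natr1.
  under [X in _ <= X + _]eq_bigr do rewrite mulrDl.
  rewrite big_split/=; have := xs i k; have := jmin k; lra.
Qed.

(** After [n] rounds the regrets are of order the square root of [n], so the average regret falls
    below [e / 2]; the other half of [e] goes to the almost best replies. The mixed strategy of the
    column player is the uniform one on the list [s], counted with multiplicity. *)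
Lemma approx_minimax (j0 : J) (e : R) : 0 < e ->
  exists (x : 'I_m.+1 -> R) (s : seq J),
    [/\ forall i, 0 <= x i, \sum_i x i = 1, (0 < size s)%N &
        forall i j, (\sum_(k <- s) A i k) / (size s)%:R <=
          \sum_k x k * A k j + e].
Proof.
move=> e0; have h0 : 0 < e / 2 by rewrite divr_gt0.
set D := m.+1%:R * (2 * C) ^+ 2.
(* With this [n] the potential bound [n * D] is at most the square of [n * (e / 2)]. *)
pose n := (Num.truncn (D / (e / 2) ^+ 2)).+1.
have [x [s [r [x0 x1 sn rn xs]]]] := regret_matching j0 n h0.
have n0 : 0 < n%:R :> R by rewrite ltr0n.
have rlt i : r i <= n%:R * (e / 2).
  apply: (@le_trans _ _ (pos (r i))); first by rewrite le_max lexx.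
  rewrite -(@ler_pXn2r _ 2)// ?nnegrE ?le_max ?lexx ?orbT ?mulr_ge0
    ?(ltW e0) ?(ltW h0)//.
  apply: (@le_trans _ _ (n%:R * D)).
    apply: le_trans rn; rewrite (bigD1 i)//= lerDl.
    by apply: sumr_ge0 => ? _; rewrite exprn_ge0// le_max lexx orbT.
  rewrite exprMn expr2 -mulrA ler_wpM2l ?ler0n// -ler_pdivrMr ?exprn_gt0//.
  by apply: ltW; rewrite /n truncnS_gt.
exists (fun i => x i / n%:R), s; split.
- by move=> i; rewrite divr_ge0// ler0n.
- by rewrite -mulr_suml x1 divff// gt_eqF.
- by rewrite sn.
- move=> i j; rewrite sn ler_pdivrMr// mulrDl mulr_suml.
  rewrite (eq_bigr (fun k => x k * A k j)); last first.
    by move=> k _; rewrite mulrAC divfK// gt_eqF.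
  have := xs i j; have := rlt i; lra.
Qed.

End minimax.

(** * Limits along an ultrafilter *)

Section ultrafilter.
Context (I : Type) (U : set_system I) (U_ultra : UltraFilter U).

Lemma ultra_fmap (X : Type) (f : I -> X) : UltraFilter (f @ U).
Proof.
split; first exact: fmap_proper_filter.
move=> G GF UG; rewrite eqEsubset; split=> // A GA.
have [//|UA] := in_ultra_setVsetC (f @^-1` A) U_ultra.
have : G (~` A) by apply: UG.
by move=> GcA; have [x []] := filter_ex (filterI GA GcA).
Qed.

(** Every family with values in a compact set converges along [U], so limits of several families can
    be taken simultaneously without extracting subnets. *)
Lemma ultra_compact_cvg (X : topologicalType) (A : set X) (f : I -> X) :
  compact A -> (forall i, A (f i)) -> exists2 x, A x & f @ U --> x.
Proof.
rewrite compact_ultra => /(_ _ (ultra_fmap f)) cA fA.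
have [|x [Ax fx]] := cA; last by exists x.
suff /= -> : (f @ U) A = U setT by exact: (@filterT _ U _).
by congr U; apply/seteqP; split => // i _; exact: fA.
Qed.

Lemma ultra_bounded_cvg (R : realType) (f : I -> R) (M : R) :
  (forall i, `|f i| <= M) -> cvg (f @ U).
Proof.
move=> fM; have [||l _ fl] := @ultra_compact_cvg R `[(- M), M]%classic f.
- exact: segment_compact.
- by move=> i; rewrite /= in_itv/= -ler_norml.
- by apply/cvg_ex; exists l.
Qed.

End ultrafilter.

(** * Riesz representation on a compact space *)

Section riesz_content.
Context (R : realType) (K : ptopologicalType).
Hypotheses (K_hausdorff : hausdorff_space K) (K_compact : compact [set: K]).
Variable nu : set K -> R.
Hypotheses (nu_ge0 : forall A, 0 <= nu A)
  (nuU : forall A B, A `&` B = set0 -> nu (A `|` B) = nu A + nu B).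
Implicit Types (A B F U V : set K).

Let nu0 : nu set0 = 0.
Proof. by have := @nuU set0 set0 (setI0 _); rewrite setU0; lra. Qed.

Let nu_le A B : A `<=` B -> nu A <= nu B.
Proof.
by move=> AB; rewrite -(setDUK AB) nuU ?setDIK// lerDl.
Qed.

Let nuU_le A B : nu (A `|` B) <= nu A + nu B.
Proof.
rewrite -[A `|` B](setDUK (@subsetUl _ A B)) nuU ?setDIK//.
by rewrite lerD2l nu_le// => x [[]].
Qed.

Let inner_set U := [set nu F | F in [set F | closed F /\ F `<=` U]].
(** The set function [nu] is only finitely additive. Regularizing it from inside by closed sets,
    which are compact here, produces countable subadditivity on open sets. *)
Definition inner_content U : R := sup (inner_set U).

Let inner_has_sup U : has_sup (inner_set U).
Proof.
split; first by exists (nu set0), set0 => //; split => //; exact: closed0.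
by exists (nu setT) => _ [F _ <-]; exact: nu_le.
Qed.

Let inner_ub U F : closed F -> F `<=` U -> nu F <= inner_content U.
Proof.
by move=> cF FU; apply: ub_le_sup; [exact: (inner_has_sup U).2|exists F].
Qed.

Let inner_le U x : (forall F, closed F -> F `<=` U -> nu F <= x) ->
  inner_content U <= x.
Proof.
move=> H; apply: ge_sup; first exact: (inner_has_sup U).1.
by move=> _ [F [cF FU] <-]; exact: H.
Qed.

Lemma inner_content_le_content U : inner_content U <= nu U.
Proof. by apply: inner_le => F _; exact: nu_le. Qed.

Let inner_mono U V : U `<=` V -> inner_content U <= inner_content V.
Proof.
move=> UV; apply: inner_le => F cF FU; apply: inner_ub => //.
exact: subset_trans UV.
Qed.

Let inner_ge0 U : 0 <= inner_content U.
Proof. by rewrite -nu0; apply: inner_ub => //; exact: closed0. Qed.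

Lemma inner_contentT : inner_content setT = nu setT.
Proof.
by apply/eqP; rewrite eq_le inner_content_le_content inner_ub//; exact: closedT.
Qed.

Let inner0 : inner_content set0 = 0.
Proof.
by apply/eqP; rewrite eq_le inner_ge0 andbT -nu0 inner_content_le_content.
Qed.

(* By normality, a closed subset of [U `|` V] is the union of a closed subset of
   [U] and a closed subset of [V]. *)
Let innerU U V : open U -> open V ->
  inner_content (U `|` V) <= inner_content U + inner_content V.
Proof.
move=> oU oV; apply: inner_le => F cF FUV.
have cFV : closed (F `\` V) by apply: closedI => //; exact: open_closedC.
have /(compact_normal K_hausdorff K_compact cFV) [C] : set_nbhs (F `\` V) U.
  apply/set_nbhsP; exists U; split => // x [Fx nVx].
  by have [] := FUV _ Fx.
move=> /set_nbhsP[W [oW FVW WC]] CU.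
have FE : F = (F `&` closure C) `|` (F `\` W).
  apply/seteqP; split => [x Fx|x [[]|[]]]//.
  have [Wx|nWx] := pselect (W x); [left|right] => //.
  by split=> //; apply: subset_closure; exact: WC.
rewrite {1}FE (le_trans (nuU_le _ _))// lerD// inner_ub//.
- by apply: closedI => //; exact: closed_closure.
- by move=> x [_ /CU].
- by apply: closedI => //; exact: open_closedC.
- by move=> x [Fx nWx]; apply: contrapT => nVx; apply: nWx; exact: FVW.
Qed.

Let inner_bigU (U : (set K)^nat) n : (forall i, open (U i)) ->
  inner_content (\big[setU/set0]_(i < n) U i) <=
    \sum_(i < n) inner_content (U i).
Proof.
move=> oU; elim: n => [|n ih]; first by rewrite !big_ord0 inner0.
rewrite !big_ord_recr/= (le_trans (innerU _ _))//.
  by rewrite -bigcup_mkord; apply: bigcup_open.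
by rewrite lerD2r.
Qed.

(** A closed subset of the union is compact, hence contained in a finite subunion, to which finite
    subadditivity applies. *)
Let inner_bigcup (U : (set K)^nat) : (forall i, open (U i)) ->
  ((inner_content (\bigcup_i U i))%:E <=
    \sum_(i <oo) (inner_content (U i))%:E)%E.
Proof.
move=> oU.
have cvr F : closed F -> F `<=` \bigcup_i U i ->
    exists n, F `<=` \big[setU/set0]_(i < n) U i.
  move=> cF FU.
  have := subclosed_compact cF K_compact (@subsetT _ F).
  rewrite compact_cover => /(_ nat setT U (fun i _ => oU i) FU) [D _ FD].
  (* The union runs over indices strictly below the bound, hence one more than the largest index of
     the finite subcover. *)
  exists (\max_(i <- finmap.enum_fset D) i).+1 => x /FD[i /= iD Uix].
  rewrite -bigcup_mkord; exists i => //=.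
  by rewrite ltnS; apply: leq_bigmax_seq.
case E : (\sum_(i <oo) _)%E => [r| |]; last 2 first.
- by rewrite leey.
- have : (0 <= \sum_(i <oo) (inner_content (U i))%:E)%E.
    by apply: nneseries_ge0 => n _ _; rewrite lee_fin.
  by rewrite E.
rewrite lee_fin; apply: inner_le => F cF /(cvr _ cF)[n Fn].
apply: (le_trans (inner_ub cF Fn)); apply: (le_trans (inner_bigU _ oU)).
rewrite -lee_fin -E -sumEFin.
rewrite -(big_mkord xpredT (fun i => (inner_content (U i))%:E)).
by apply: nneseries_lim_ge => i _ _; rewrite lee_fin.
Qed.

Local Open Scope ereal_scope.

Let outer_set A :=
  [set (inner_content U)%:E | U in [set U | open U /\ A `<=` U]].
Definition outer_content A : \bar R := ereal_inf (outer_set A).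

Let outer_lb A U : open U -> A `<=` U ->
  outer_content A <= (inner_content U)%:E.
Proof. by move=> oU AU; apply: ereal_inf_lbound; exists U. Qed.

Let outer_ge0 A : 0 <= outer_content A.
Proof. by apply: le_ereal_inf_tmp => _ [U _ <-]; rewrite lee_fin. Qed.

Let outer_fin A : outer_content A \is a fin_num.
Proof.
rewrite ge0_fin_numE//; apply: le_lt_trans (outer_lb openT (@subsetT _ A)) _.
by rewrite ltry.
Qed.

Lemma outer_content_open U : open U -> outer_content U = (inner_content U)%:E.
Proof.
move=> oU; apply/eqP; rewrite eq_le outer_lb//=.
by apply: le_ereal_inf_tmp => _ [V [oV UV] <-]; rewrite lee_fin inner_mono.
Qed.

Let outer0 : outer_content set0 = 0.
Proof. by rewrite outer_content_open ?inner0//; exact: open0. Qed.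

Let outer_mono : {homo outer_content : A B / A `<=` B >-> A <= B}.
Proof.
move=> A B AB; apply: ereal_inf_le_tmp => _ [U [oU BU] <-]; exists U => //.
by split=> //; exact: subset_trans BU.
Qed.

Let outer_sigma_subadditive : sigma_subadditive outer_content.
Proof.
move=> A; apply/lee_addgt0Pr => e e0.
have /choice[U HU] : forall n, exists U, [/\ open U, A n `<=` U &
    (inner_content U)%:E <= outer_content (A n) + (e / (2 ^ n.+1)%:R)%:E].
  move=> n; have en : (0 < e / (2 ^ n.+1)%:R)%R.
    by rewrite divr_gt0// ltr0n expn_gt0.
  have [_ [U [oU AU] <-] Ulb] := lb_ereal_inf_adherent en (outer_fin (A n)).
  by exists U; split => //; exact: ltW.
have oU n : open (U n) by have [] := HU n.
apply: (@le_trans _ _ (inner_content (\bigcup_n U n))%:E).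
  apply: outer_lb; first exact: bigcup_open.
  by apply: subset_bigcup => n _; have [] := HU n.
apply: (le_trans (inner_bigcup oU)).
apply: (@le_trans _ _
    (\sum_(n <oo) (outer_content (A n) + (e / (2 ^ n.+1)%:R)%:E))).
  by apply: lee_nneseries => n *; [rewrite lee_fin|have [] := HU n].
by apply: epsilon_trick => //; exact: ltW.
Qed.

HB.instance Definition _ := isOuterMeasure.Build R K outer_content
  outer0 outer_ge0 outer_mono outer_sigma_subadditive.

(** It suffices to split an open [V] containing [X]. A closed [F] inside [V] and [U], followed by a
    closed [G] inside [V] minus [F], are disjoint closed subsets of [V], so additivity of [nu]
    bounds the sum of their contents by that of [V]. Suprema over [G], then over [F], give the
    inequality. *)
Let open_caratheodory U : open U -> outer_content.-caratheodory U.
Proof.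
move=> oU; apply: le_caratheodory_measurable => X.
apply: le_ereal_inf_tmp => _ [V [oV XV] <-].
have : outer_content (X `&` U) <= (inner_content (V `&` U))%:E.
  by apply: outer_lb; [exact: openI|exact: setSI].
move=> /leeD2r/le_trans; apply.
rewrite -[X in _ + X](fineK (outer_fin _)) -EFinD lee_fin -lerBrDr.
apply: inner_le => F cF FVU; rewrite lerBrDr -lerBrDl.
rewrite -lee_fin fineK ?outer_fin//.
have oVF : open (V `&` ~` F) by apply: openI => //; exact: closed_openC.
apply: (@le_trans _ _ (inner_content (V `&` ~` F))%:E).
  apply: outer_lb => // x [/XV Vx nUx]; split => // Fx.
  by apply: nUx; have [] := FVU _ Fx.
rewrite lee_fin; apply: inner_le => G cG GVF; rewrite lerBrDl -nuU.
  apply: inner_ub; first exact: closedU.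
  by move=> x [/FVU[]|/GVF[]].
by apply/seteqP; split => // x [Fx /GVF[]].
Qed.

Let sigma_open_caratheodory :
  <<s @open K >> `<=` outer_content.-cara.-measurable.
Proof.
apply: smallest_sub => //.
exact: (sigma_algebra_measurable (caratheodory_type outer_content)).
Qed.

Definition outer_content_borel :
    set (g_sigma_algebraType (@open K)) -> \bar R :=
  outer_content.

Let borel0 : outer_content_borel set0 = 0.
Proof. exact: outer0. Qed.

Let borel_ge0 A : 0 <= outer_content_borel A.
Proof. exact: outer_ge0. Qed.

Let borel_sigma_additive : semi_sigma_additive outer_content_borel.
Proof.
move=> A mA tA mUA.
apply: (@caratheodory_measure_sigma_additive R K outer_content A) => //.
- by move=> n; apply: sigma_open_caratheodory; exact: mA.
- exact: sigma_open_caratheodory.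
Qed.

HB.instance Definition _ := isMeasure.Build _ _ _ outer_content_borel
  borel0 borel_ge0 borel_sigma_additive.

Let borel_fin : fin_num_fun outer_content_borel.
Proof. by move=> A _; exact: outer_fin. Qed.

HB.instance Definition _ := Measure_isFinite.Build _ _ _ outer_content_borel
  borel_fin.

(** Domination on open sets bounds integrals of nonnegative continuous functions from above;
    equality of the total masses later turns this into equality by passing to complements. *)
Lemma open_content_measure :
  exists la : {finite_measure set (g_sigma_algebraType (@open K)) -> \bar R},
    la setT = (nu setT)%:E /\ forall U, open U -> la U <= (nu U)%:E.
Proof.
exists outer_content_borel; split=> [|U oU].
  by rewrite [LHS]outer_content_open ?inner_contentT//; exact: openT.
by rewrite [leLHS]outer_content_open// lee_fin inner_content_le_content.
Qed.

End riesz_content.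

Lemma indic_setU (T : Type) (R : pzRingType) (A B : set T) : A `&` B = set0 ->
  \1_(A `|` B) = (fun x => \1_A x + \1_B x) :> (T -> R).
Proof.
move=> AB; apply/funext => x; rewrite !indicE in_setU.
have [xA|_] := boolP (x \in A) => /=; last by rewrite add0r.
have [xB|_] := boolP (x \in B); last by rewrite addr0.
by have : set0 x by rewrite -AB; split; exact: set_mem.
Qed.

(** * Positive functionals as integrals *)

Section riesz.
Context (R : realType).

(** The sum is [d] times the number of levels [d], [2 * d], ..., [N * d] strictly below [x]: it
    approximates [x] from below within [d] as long as [x] is at most [N * d]. The inequality is
    strict so that the level sets of a continuous function are open. *)
Lemma sum_layers (d x : R) (N : nat) : 0 < d -> 0 <= x ->
  (\sum_(k < N) d * (k.+1%:R * d < x)%R%:R <= x) /\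
  (x <= N%:R * d -> x <= d + \sum_(k < N) d * (k.+1%:R * d < x)%R%:R).
Proof.
move=> d0 x0; have full n : n%:R * d < x ->
    \sum_(k < n) d * (k.+1%:R * d < x)%R%:R = n%:R * d.
  move=> nx; rewrite (eq_bigr (fun=> d)); last first.
    move=> k _; have -> : k.+1%:R * d < x.
      by apply: le_lt_trans nx; rewrite ler_wpM2r ?(ltW d0)// ler_nat.
    by rewrite mulr1.
  by rewrite sumr_const card_ord mulr_natl.
elim: N => [|N [lo up]].
  by rewrite big_ord0 mul0r; split=> // x0'; rewrite addr0 (le_trans x0')// ltW.
have [h|h] := ltP (N.+1%:R * d) x.
  by rewrite full//; split=> //; exact: ltW.
rewrite big_ord_recr/= [(_ * d < x)%R in X in _ + X]ltNge h mulr0 addr0.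
split=> // _.
have [/up//|{}h'] := leP x (N%:R * d).
by rewrite full// -[d in d + _]mul1r -mulrDl nat1r.
Qed.

Lemma continuous_open_measurable (K : ptopologicalType) (f : K -> R) :
  continuous f ->
  measurable_fun [set: g_sigma_algebraType (@open K)]
    (f : g_sigma_algebraType (@open K) -> R).
Proof.
move=> cf; apply: (measurability (@RGenOInfty.G R)).
  exact: RGenOInfty.measurableE.
move=> _ [_ [a ->] <-]; rewrite setTI; apply: sub_sigma_algebra.
by move/continuousP : cf; apply; rewrite set_itvoy; exact: open_gt.
Qed.

Context (K : ptopologicalType) (Lam : (K -> R) -> R).
Hypotheses (K_hausdorff : hausdorff_space K) (K_compact : compact [set: K]).

Local Notation bounded f := (exists M : R, forall z, `|f z| <= M).

Hypotheses
  (LamD : forall f g : K -> R, bounded f -> bounded g ->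
    Lam (fun z => f z + g z) = Lam f + Lam g)
  (LamZ : forall c (f : K -> R), bounded f ->
    Lam (fun z => c * f z) = c * Lam f)
  (Lam_ge0 : forall f : K -> R, bounded f -> (forall z, 0 <= f z) ->
    0 <= Lam f).

Let bddD (f g : K -> R) : bounded f -> bounded g ->
  bounded (fun z => f z + g z).
Proof.
move=> [M fM] [N gN]; exists (M + N) => z.
by rewrite (le_trans (ler_normD _ _))// lerD.
Qed.

Let bddZ c (f : K -> R) : bounded f -> bounded (fun z => c * f z).
Proof.
by move=> [M fM]; exists (`|c| * M) => z; rewrite normrM ler_wpM2l.
Qed.

Let bdd_indic (A : set K) : bounded (\1_A : K -> R).
Proof.
by exists 1 => z; rewrite indicE; case: (_ \in _); rewrite ?normr0 ?normr1.
Qed.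

Let bdd_sum n (f : nat -> K -> R) : (forall k, bounded (f k)) ->
  bounded (fun z => \sum_(k < n) f k z).
Proof.
move=> bf; elim: n => [|n ih].
  by exists 0 => z; rewrite big_ord0 normr0.
under eq_exists do under eq_forall do rewrite big_ord_recr/=.
exact: bddD.
Qed.

Let Lam_le (f g : K -> R) : bounded f -> bounded g -> (forall z, f z <= g z) ->
  Lam f <= Lam g.
Proof.
move=> bf bg fg.
have bh : bounded (fun z => g z + (-1) * f z) by apply: bddD => //; exact: bddZ.
have -> : g = (fun z => f z + (g z + (-1) * f z)) by apply/funext => z; ring.
by rewrite LamD// lerDl Lam_ge0// => z; rewrite mulN1r subr_ge0.
Qed.

Let Lam_sum n (f : nat -> K -> R) : (forall k, bounded (f k)) ->
  Lam (fun z => \sum_(k < n) f k z) = \sum_(k < n) Lam (f k).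
Proof.
move=> bf; elim: n => [|n ih].
  under eq_fun do rewrite big_ord0.
  rewrite big_ord0 -[RHS](mul0r (Lam \1_setT)) -LamZ//.
  by congr Lam; apply/funext => z; rewrite mul0r.
under eq_fun do rewrite big_ord_recr/=.
by rewrite LamD// ?ih ?big_ord_recr//; exact: bdd_sum.
Qed.

(** Since [Lam] acts on all bounded functions, applying it to indicators gives a content on all
    subsets. Layer sums over open level sets show that the integral is at most [Lam f] for
    nonnegative [f], and shifts by constants give both inequalities for a general [f]. *)
Theorem riesz_representation :
  exists la : {finite_measure set (g_sigma_algebraType (@open K)) -> \bar R},
    forall f : K -> R, continuous f -> (\int[la]_z (f z)%:E = (Lam f)%:E)%E.
Proof.
pose nu (A : set K) := Lam \1_A.
have nu0 A : 0 <= nu A by apply: Lam_ge0.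
have nuU A B : A `&` B = set0 -> nu (A `|` B) = nu A + nu B.
  by move=> AB; rewrite /nu indic_setU// LamD.
have [la [laT laU]] := open_content_measure K_hausdorff K_compact nu0 nuU.
exists la.
have int_cst c : (\int[la]_z c%:E = (c * nu setT)%:E)%E.
  by rewrite integral_cst// EFinM; congr (_ * _)%E; exact: laT.
have cst_cont M f : continuous f -> continuous (fun z : K => M + f z : R).
  by move=> cf z; apply: cvgD; [exact: cvg_cst|exact: cf].
have LamC M : Lam (fun=> M) = M * nu setT.
  by rewrite /nu -LamZ//; congr Lam; apply/funext => z; rewrite indicT mulr1.
have half M (f : K -> R) : continuous f -> (forall z, 0 <= f z <= M) ->
    (\int[la]_z (f z)%:E <= (Lam f)%:E)%E.
  move=> cf f0M; apply/lee_addgt0Pr => e e0.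
  (* The discretization costs [d * nu setT], which is at most [e]; the summand 1 avoids a division
     by zero when the total mass vanishes. *)
  pose d := e / (1 + nu setT).
  have d0 : 0 < d by rewrite divr_gt0// ltr_pwDl.
  pose N := (Num.truncn (M / d)).+1.
  have MN z : f z <= N%:R * d.
    rewrite (le_trans (andP (f0M z)).2)// -ler_pdivrMr//.
    by apply: ltW; rewrite truncnS_gt.
  pose V k := [set z | k.+1%:R * d < f z].
  have oV k : open (V k).
    rewrite (_ : V k = f @^-1` [set y | k.+1%:R * d < y])//.
    by move/continuousP : cf; apply; exact: open_gt.
  have VE z : \sum_(k < N) d * \1_(V k) z =
      \sum_(k < N) d * (k.+1%:R * d < f z)%R%:R.
    apply: eq_bigr => k _; rewrite indicE; congr (_ * (nat_of_bool _)%:R).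
    by apply/idP/idP => [/set_mem|/mem_set].
  have f0 z : 0 <= f z by have /andP[] := f0M z.
  have mV k : measurable (V k : set (g_sigma_algebraType (@open K))).
    exact: sub_sigma_algebra.
  apply: (@le_trans _ _ (\int[la]_z (d + \sum_(k < N) d * \1_(V k) z)%:E)%E).
    apply: ge0_le_integral => //.
    - by move=> z _; rewrite lee_fin.
    - by apply/measurable_EFinP; exact: continuous_open_measurable.
    - under eq_fun do rewrite EFinD -sumEFin.
      apply: emeasurable_funD => //; apply: emeasurable_sum => k.
      by apply/measurable_EFinP; apply: measurable_funM.
    - by move=> z _; rewrite lee_fin VE; exact: (sum_layers N d0 (f0 z)).2.
  under eq_integral do rewrite EFinD -sumEFin.
  rewrite ge0_integralD//; last 3 first.
  - by move=> z _; rewrite lee_fin ltW.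
  - by move=> z _; apply: sume_ge0 => k _; rewrite lee_fin mulr_ge0// ltW.
  - apply: emeasurable_sum => k; apply/measurable_EFinP.
    by apply: measurable_funM => //; exact: measurable_indic.
  rewrite int_cst ge0_integral_sum//; last 2 first.
  - move=> k; apply/measurable_EFinP.
    by apply: measurable_funM => //; exact: measurable_indic.
  - by move=> k z _; rewrite lee_fin mulr_ge0// ltW.
  rewrite addeC; apply: leeD; last first.
    rewrite lee_fin /d mulrAC ler_pdivrMr ?ltr_pwDl// ler_wpM2l ?ltW//.
    by rewrite ltrDr.
  apply: (@le_trans _ _ (\sum_(k < N) (d * nu (V k))%:E)%E).
    apply: lee_sum => k _; under eq_integral do rewrite EFinM.
    rewrite ge0_integralZl_EFin//; last 2 first.
    - by apply/measurable_EFinP; exact: measurable_indic.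
    - exact: ltW.
    rewrite integral_indic// setIT [leRHS]EFinM.
    by apply: lee_wpmul2l; [rewrite lee_fin ltW|exact: laU].
  rewrite sumEFin lee_fin; under eq_bigr do rewrite -LamZ//.
  rewrite -(Lam_sum N (f := fun k z => d * \1_(V k) z))//; last first.
    by move=> k; exact: bddZ.
  apply: Lam_le => [||z].
  - by apply: (@bdd_sum N (fun k z => d * \1_(V k) z)) => k; exact: bddZ.
  - by exists M => z; have /andP[? ?] := f0M z; rewrite ger0_norm.
  - by rewrite VE; exact: (sum_layers N d0 (f0 z)).1.
move=> f cf.
have [M fM] : bounded f.
  have : compact (f @` setT).
    by apply: continuous_compact => //; exact: continuous_subspaceT.
  move=> /compact_bounded[M [_ fM]]; exists (M + 1) => z.
  by apply: (fM (M + 1)); [rewrite ltrDl|exists z].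
have bc (c : R) : exists M : R, forall z : K, `|c| <= M by exists `|c|.
have fla : la.-integrable setT (EFin \o f).
  apply: measurable_bounded_integrable => //.
  - by rewrite -ge0_fin_numE//; exact: fin_num_measure.
  - exact: continuous_open_measurable.
  - exists M; split; [exact: num_real|move=> x Mx z _ /=].
    by rewrite (le_trans (fM z))// ltW.
have cla c : la.-integrable setT (EFin \o cst c).
  by apply: finite_measure_integrable_cst.
apply/eqP; rewrite eq_le; apply/andP; split.
(* Both [M + f] and [M - f] lie between 0 and [2 * M]. The constant contributes [M * nu setT] on
   each side and cancels, leaving opposite inequalities for [f]. *)
- have := half (M + M) (fun z => M + f z) (cst_cont M f cf).
  rewrite LamD//; last by exists M.
  rewrite LamC; under eq_integral do rewrite EFinD.
  rewrite integralD//; last exact: cla.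
  rewrite [X in (X + _)%E]int_cst EFinD.
  rewrite leeD2lE//; apply => z.
  by move: (fM z); rewrite ler_norml => /andP[? ?]; apply/andP; split; lra.
- have := half (M + M) (fun z => M + (-1) * f z).
  rewrite LamD//; last by apply: bddZ; exists M.
  rewrite LamC LamZ//; last by exists M.
  under eq_integral do rewrite EFinD EFinM.
  rewrite integralD//; [|exact: cla|exact: integrableZl].
  rewrite integralZl// [X in (X + _)%E]int_cst EFinD.
  rewrite leeD2lE// mulN1r !EFinN mulN1e leeN2; apply.
  + apply: cst_cont => z; apply: cvgM; [exact: cvg_cst|exact: cf].
  + move=> z.
    by move: (fM z); rewrite ler_norml => /andP[? ?]; apply/andP; split; lra.
Qed.

End riesz.

(** * Compactness of tests *)

Section tests_compact.
Context d (T : measurableType d) (R : realType) (mu : probability T R).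
Implicit Types (phi psi u v : T -> R).

Local Notation L1 u := (mu.-integrable [set: T] (EFin \o u)).

Lemma integrableM_test phi u : tests phi -> L1 u -> L1 (fun w => phi w * u w).
Proof.
move=> [mphi phi01] iu; apply: (le_integrable _ _ _ iu) => //.
  apply/measurable_EFinP; apply: measurable_funM => //.
  by apply/measurable_EFinP; exact: measurable_int iu.
move=> w _; rewrite /= lee_fin normrM; have /andP[p0 p1] := phi01 w.
by rewrite ger0_norm// ler_piMl.
Qed.

Lemma integrable_indicR (A : set T) : measurable A -> L1 (\1_A : T -> R).
Proof. exact: integrable_indic. Qed.

Lemma integrableDR u v : L1 u -> L1 v -> L1 (fun w => u w + v w).
Proof. by move=> iu iv; exact: (integrableD measurableT iu iv). Qed.

Lemma integrableZR (c : R) u : L1 u -> L1 (fun w => c * u w).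
Proof. by move=> iu; exact: (integrableZl measurableT c iu). Qed.

Lemma integrableBR u v : L1 u -> L1 v -> L1 (fun w => u w - v w).
Proof. by move=> iu iv; exact: (integrableB measurableT iu iv). Qed.

Lemma integrable_sumR (J : Type) (s : seq J) (f : J -> T -> R) :
  (forall j, L1 (f j)) -> L1 (fun w => \sum_(j <- s) f j w).
Proof.
move=> fi; elim: s => [|j s ih].
  under [X in _.-integrable _ (EFin \o X)]eq_fun do rewrite big_nil.
  exact: integrable0.
under [X in _.-integrable _ (EFin \o X)]eq_fun do rewrite big_cons.
exact: integrableDR.
Qed.

Lemma Rintegral_sum (J : Type) (s : seq J) (f : J -> T -> R) :
  (forall j, L1 (f j)) ->
  \int[mu]_w (\sum_(j <- s) f j w) = \sum_(j <- s) \int[mu]_w f j w.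
Proof.
move=> fi; elim: s => [|j s ih].
  rewrite big_nil; under eq_Rintegral do rewrite big_nil.
  by rewrite Rintegral_cst// mul0r.
under eq_Rintegral do rewrite big_cons.
by rewrite RintegralD//; [rewrite big_cons ih|exact: integrable_sumR].
Qed.

Lemma normr_test_integral_le phi u : tests phi -> L1 u ->
  `|\int[mu]_w (phi w * u w)| <= \int[mu]_w `|u w|.
Proof.
move=> tphi iu; have iphi := integrableM_test tphi iu.
apply: (le_trans (le_normr_Rintegral _ iphi)) => //.
apply: le_Rintegral => //; [exact: integrable_norm|exact: integrable_norm|].
move=> w _; have /andP[p0 p1] := tphi.2 w.
by rewrite normrM ger0_norm// ler_piMl.
Qed.

Context (I : Type) (U : set_system I) (U_ultra : UltraFilter U).
Variable phi : I -> T -> R.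
Hypothesis tphi : forall i, tests (phi i).

Let G u : R := lim ((fun i => \int[mu]_w (phi i w * u w)) @ U).

Let G_cvg u : L1 u -> (fun i => \int[mu]_w (phi i w * u w)) @ U --> G u.
Proof.
move=> iu; apply: (@ultra_bounded_cvg I U U_ultra R _ (\int[mu]_w `|u w|)) => i.
exact: normr_test_integral_le.
Qed.

Let GD u v : L1 u -> L1 v -> G (fun w => u w + v w) = G u + G v.
Proof.
move=> iu iv; apply/cvg_lim => //.
under eq_fun do (under eq_Rintegral do rewrite mulrDr;
  rewrite RintegralD//; try exact: integrableM_test).
by apply: cvgD; exact: G_cvg.
Qed.

Let GZ (c : R) u : L1 u -> G (fun w => c * u w) = c * G u.
Proof.
move=> iu; apply/cvg_lim => //.
under eq_fun do (under eq_Rintegral do rewrite mulrCA;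
  rewrite RintegralZl//; try exact: integrableM_test).
by apply: cvgM; [exact: cvg_cst|exact: G_cvg].
Qed.



Let G0 u : L1 u -> (forall w, 0 <= u w) -> 0 <= G u.
Proof.
move=> iu u0; apply: limr_ge; first exact: G_cvg.
apply: nearW => i; apply: Rintegral_ge0 => w _.
by rewrite mulr_ge0//; have /andP[] := (tphi i).2 w.
Qed.

Let G_norm u : L1 u -> `|G u| <= \int[mu]_w `|u w|.
Proof.
move=> iu; rewrite ler_norml; apply/andP; split.
  apply: limr_ge; first exact: G_cvg.
  apply: nearW => i; have := normr_test_integral_le (tphi i) iu.
  by rewrite ler_norml => /andP[].
apply: limr_le; first exact: G_cvg.
apply: nearW => i; have := normr_test_integral_le (tphi i) iu.
by rewrite ler_norml => /andP[].
Qed.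

Let G_sum (J : Type) (s : seq J) (f : J -> T -> R) : (forall j, L1 (f j)) ->
  G (fun w => \sum_(j <- s) f j w) = \sum_(j <- s) G (f j).
Proof.
move=> fi; elim: s => [|j s ih].
  under eq_fun do rewrite big_nil.
  rewrite big_nil; have := GZ 0 (integrable_indicR measurableT).
  by rewrite mul0r; under [X in G X]eq_fun do rewrite mul0r.
under eq_fun do rewrite big_cons.
by rewrite GD//; [rewrite big_cons ih|exact: integrable_sumR].
Qed.

(** The functional [G] is controlled on integrable functions only; the default value 0 keeps [nu]
    nonnegative on nonmeasurable sets as well. *)
Let nu (A : set T) : \bar R :=
  (if pselect (measurable A) then G \1_A else 0)%:E.

Let nuE A : measurable A -> nu A = (G \1_A)%:E.
Proof. by rewrite /nu; case: pselect. Qed.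

Let GU A B : measurable A -> measurable B -> A `&` B = set0 ->
  nu (A `|` B) = (nu A + nu B)%E.
Proof.
move=> mA mB AB; rewrite !nuE//; last exact: measurableU.
by rewrite indic_setU// GD//; exact: integrable_indicR.
Qed.

Let Rint_indic (A : set T) : measurable A -> (\int[mu]_w \1_A w)%:E = mu A.
Proof.
move=> mA; rewrite /Rintegral integral_indic// setIT fineK//.
exact: fin_num_measure.
Qed.

Let nu_set0 : nu set0 = 0%E.
Proof.
have := GU measurable0 measurable0 (setI0 _).
by rewrite setU0 !nuE// -EFinD => -[] h; congr EFin; lra.
Qed.

Let nu_ge0 A : (0 <= nu A)%E.
Proof.
rewrite /nu lee_fin; case: pselect => // mA.
by apply: G0 => //; exact: integrable_indicR.
Qed.

Let nu_le_mu A : measurable A -> (nu A <= mu A)%E.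
Proof.
move=> mA; rewrite nuE// -Rint_indic// lee_fin.
have := G_norm (integrable_indicR mA).
under eq_Rintegral do rewrite ger0_norm//.
by apply: le_trans; exact: ler_norm.
Qed.

(* The defect of sigma-additivity of [nu] is dominated by that of [mu]. *)
Let nu_sigma_additive : semi_sigma_additive nu.
Proof.
move=> A mA tA mUA.
have mUn n : measurable (\big[setU/set0]_(i < n) A i).
  by exact: bigsetU_measurable.
have nuD B C : measurable B -> measurable C -> B `<=` C ->
    (nu C - nu B <= mu C - mu B)%E /\ (nu B <= nu C)%E.
  move=> mB mC BC; have mCB : measurable (C `\` B) by exact: measurableD.
  have E1 : nu C = (nu (C `\` B) + nu B)%E.
    by rewrite addeC -GU// ?setDUK// setDIK.
  have fB : nu B \is a fin_num by rewrite nuE.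
  have E2 : mu C = (mu (C `\` B) + mu B)%E.
    by rewrite addeC -measureU// ?setDUK// setDIK.
  split; last by rewrite E1 leeDr.
  rewrite E1 E2 !addeK ?fin_num_measure//.
  exact: nu_le_mu.
have nuS n : (\sum_(0 <= i < n) nu (A i))%E = nu (\big[setU/set0]_(i < n) A i).
  elim: n => [|n ih]; first by rewrite big_nil big_ord0 nu_set0.
  rewrite big_nat_recr//= ih big_ord_recr/= GU//; first exact: mUn.
  by apply: (@trivIset_bigsetUI _ predT) => //; rewrite /predT/= trueE.
set C := \bigcup_n A n in mUA *.
have UC n : \big[setU/set0]_(i < n) A i `<=` C by exact: bigsetU_bigcup.
have muS : (fun n => mu C - mu (\big[setU/set0]_(i < n) A i))%E @ \oo --> 0%E.
  rewrite -[X in _ --> X](subee (fin_num_measure mu _ mUA)).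
  apply: cvgeB => //.
    by rewrite fin_num_adde_defl// fin_numN fin_num_measure.
    exact: cvg_cst.
  under eq_fun do
    rewrite measure_bigsetU// -(big_mkord xpredT (fun i => mu (A i))).
  exact: measure_sigma_additive.
under eq_fun do rewrite nuS.
have fC : nu C \is a fin_num by rewrite nuE.
apply: (@squeeze_cvge _ _ _ _
  (fun n => nu C - (mu C - mu (\big[setU/set0]_(i < n) A i)))%E
  _ (fun=> nu C)); last 2 first.
- by rewrite -[X in _ --> X]sube0; apply: cvgeB => //; exact: cvg_cst.
- exact: cvg_cst.
apply: nearW => n; have [h1 h2] := nuD _ _ (mUn n) mUA (UC n).
rewrite h2 andbT.
have fS : nu (\big[setU/set0]_(i < n) A i) \is a fin_num by rewrite nuE.
by rewrite leeBlDr ?fin_numB ?fin_num_measure// addeC -leeBlDr.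
Qed.

HB.instance Definition _ := isMeasure.Build _ _ _ nu
  nu_set0 nu_ge0 nu_sigma_additive.

Let nu_fin : fin_num_fun nu. Proof. by move=> A mA; rewrite nuE. Qed.

HB.instance Definition _ := Measure_isFinite.Build _ _ _ nu nu_fin.

Import HBSimple.

(** This is weak-star compactness of the set of tests. The limit functional restricted to indicators
    is a measure dominated by [mu], and its Radon-Nikodym density is the limit test. The identity
    extends from indicators to simple functions by linearity and to integrable functions by
    density. *)
Lemma tests_ultra_compact : exists psi, tests psi /\
  forall u, L1 u ->
    (fun i => \int[mu]_w (phi i w * u w)) @ U --> \int[mu]_w (psi w * u w).
Proof.
have numu : nu `<< mu.
  apply/null_content_dominatesP => A mA A0.
  by apply/eqP; rewrite eq_le measure_ge0 andbT -A0; exact: nu_le_mu.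
have [h [h0 hfin ih hE]] := radon_nikodym_sigma_finite numu.
pose k w := fine (h w).
have kE : EFin \o k = h by apply/funext => w; rewrite /= fineK.
have ik : L1 k by rewrite kE.
have mk : measurable_fun setT k.
  by apply/measurable_EFinP; exact: measurable_int ik.
have k0 w : 0 <= k w by rewrite -lee_fin fineK.
pose A := [set w | 1 < k w].
have mA : measurable A.
  rewrite (_ : A = setT `&` k @^-1` `]1, +oo[); first exact: mk.
  by rewrite setTI; apply/seteqP; split=> w; rewrite /A /= in_itv/= andbT.
have k1 : {ae mu, forall w, k w <= 1}.
  (* On [A] the integrand is positive, while its integral is [nu A - mu A], which is not
     positive. *)
  have A0 : (\int[mu]_(w in A) `|(k w - 1)%:E| = 0)%E.
    apply/eqP; rewrite eq_le integral_ge0// andbT.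
    rewrite (eq_integral (fun w => (k w)%:E - 1%:E)%E); last first.
      by move=> w /set_mem/ltW ?; rewrite /= ger0_norm ?subr_ge0.
    rewrite integralB//; last 2 first.
    - by apply: (integrableS measurableT) => //; exact: ik.
    - exact: finite_measure_integrable_cst.
    rewrite integral_cst// mul1e sube_le0.
    rewrite [X in (X <= _)%E](_ : _ = nu A) ?nu_le_mu//.
    by rewrite hE// -kE.
  have mk1 : measurable_fun A (fun w => (k w - 1)%:E).
    apply/measurable_EFinP; apply: measurable_funB => //.
    exact: measurable_funTS.
  move/(ae_eq_integral_abs mu mA mk1) : A0; apply: filterS => w /= H.
  rewrite leNgt; apply/negP => kw; have := H kw.
  by move=> -[] /eqP; rewrite subr_eq0 gt_eqF.
(* The density is at most 1 only almost everywhere, whereas a test is bounded everywhere. *)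
pose psi w := Num.min (k w) 1.
have tpsi : tests psi.
  split=> [|w]; first exact: measurable_minr.
  by rewrite le_min k0 ler01 ge_min lexx orbT.
exists psi; split => // u iu.
suff <- : G u = \int[mu]_w (psi w * u w) by exact: G_cvg.
have GA (B : set T) : measurable B -> G \1_B = \int[mu]_w (psi w * \1_B w).
  move=> mB; apply: EFin_inj; rewrite -nuE// hE// -kE /Rintegral fineK; last first.
    exact: integrable_fin_num (integrableM_test tpsi (integrable_indicR mB)).
  rewrite [LHS]integral_mkcond; apply: ae_eq_integral => //.
  - apply/(measurable_restrictT _ _).1 => //; apply/measurable_EFinP.
    exact: measurable_funTS.
  - by case/integrableP : (integrableM_test tpsi (integrable_indicR mB)).
  - apply: filterS k1 => w kw _.
    rewrite patchE /psi min_l// indicE; case: ifPn => wB; first by rewrite mulr1.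
    by rewrite mulr0.
have Gsf (g : {sfun T >-> R}) : L1 g /\ G g = \int[mu]_w (psi w * g w).
  have mg y : measurable (g @^-1` [set y]) by exact: measurable_funPTI.
  have iy y : L1 (fun w => y * \1_(g @^-1` [set y]) w : R).
    by apply: integrableZR; exact: integrable_indicR.
  have -> : (g : T -> R) = fun w =>
      \sum_(y <- finmap.enum_fset (fset_set (range g)))
        y * \1_(g @^-1` [set y]) w.
    by apply/funext => w; rewrite fimfunE fsbig_finite.
  split; first exact: integrable_sumR.
  rewrite G_sum//; under [RHS]eq_Rintegral do rewrite mulr_sumr.
  rewrite Rintegral_sum//; last by move=> y; exact: integrableM_test.
  apply: eq_bigr => y _; rewrite GZ//; last exact: integrable_indicR.
  rewrite GA//; under [RHS]eq_Rintegral do rewrite mulrCA.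
  by rewrite RintegralZl//; apply: integrableM_test => //; exact: integrable_indicR.
(* Both functionals are bounded by the L1 norm, so a simple function within [e / 2] of [u] bounds
   their difference at [u] by [e]. *)
have [g [ig _ gu]] := approximation_sfun_integrable measurableT iu.
apply/eqP; rewrite -subr_eq0 -normr_le0; apply/ler_addgt0Pr => e e0.
have e20 : 0 < e / 2 by rewrite divr_gt0.
move: gu => /fine_fcvg/cvg_ballP/(_ _ e20)[n _ /(_ n (leqnn n))].
rewrite /ball/= sub0r normrN => gn.
have ign : L1 (fun w => u w - g n w) by exact: integrableBR.
have uE : u = (fun w => g n w + (u w - g n w)) by apply/funext => w; ring.
have {}gn : \int[mu]_w `|u w - g n w| < e / 2.
  by apply: le_lt_trans gn; exact: ler_norm.
have -> : G u = G (g n) + G (fun w => u w - g n w) by rewrite {1}uE GD.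
have -> : \int[mu]_w (psi w * u w) =
    \int[mu]_w (psi w * g n w) + \int[mu]_w (psi w * (u w - g n w)).
  rewrite -RintegralD//; try exact: integrableM_test.
  by apply: eq_Rintegral => w _; ring.
rewrite (Gsf (g n)).2 opprD addrACA subrr add0r (le_trans (ler_normB _ _))//.
have := G_norm ign; have := normr_test_integral_le tpsi ign; lra.
Qed.

End tests_compact.

(** * The weak topology of L1 *)

Section weak_topology_facts.
Context (R : realType) (V : normedModType R).

Lemma weak_dual_continuous (f : continuous_dual V) :
  continuous (sval f : weak V -> R).
Proof.
move=> x; have /(cvg_sup _ x)/(_ f) xf := @cvg_id (weak V) (nbhs x).
have := @initial_continuous V R (sval f) x.
by apply: cvg_trans; exact: cvg_app xf.
Qed.

(** Induction on the list: prepending [f j] to [n] entries mixes it, with weight [1 / (n + 1)], into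
    the average of the others. *)
Lemma convex_set_average (C : set V) (J : Type) (f : J -> V) (s : seq J) :
  convex_set C -> (forall j, C (f j)) -> (0 < size s)%N ->
  C ((size s)%:R^-1 *: \sum_(j <- s) f j).
Proof.
move=> cC Cf; elim: s => // j [|k s] ih _.
  by rewrite /= invr1 scale1r big_seq1.
have {ih} := ih isT; set n := size (k :: s).
set y := \sum_(_ <- k :: s) _ => ih.
have n0 : 0 < n%:R :> R by rewrite ltr0n.
have nS0 : 0 < n.+1%:R :> R by rewrite ltr0n.
have t0 : 0 <= n.+1%:R^-1 :> R by rewrite invr_ge0 ltW.
have t1 : n.+1%:R^-1 <= 1 :> R by rewrite invf_le1// ler1n.
have := cC (f j) (n%:R^-1 *: y) (Itv01 t0 t1) (mem_set (Cf j)) (mem_set ih).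
move=> /set_mem; rewrite big_cons -/y [size _]/= -/n.
congr C; rewrite -[LHS]/(n.+1%:R^-1 *: f j + (1 - n.+1%:R^-1) *: (n%:R^-1 *: y)).
rewrite scalerDr scalerA; congr (_ + _ *: _).
have -> : n.+1%:R = n%:R + 1 :> R by rewrite natr1.
by field; rewrite natr1 !lt0r_neq0.
Qed.

(** The Riesz theorem needs a compact type rather than a compact subset. An ultrafilter on the
    subtype is pushed forward to [X], and its limit, which lies in [A], is a limit in the
    subspace. *)
Lemma compact_subset_type (X : topologicalType) (A : set X) :
  compact A -> compact [set: (A : Type)].
Proof.
rewrite !compact_ultra => cA F FU _.
have [||x [Ax Fx]] := cA (set_val @ F).
- exact: ultra_fmap.
- rewrite /fmap/=; apply: filterS (@filterT _ F _) => z _ /=.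
  exact: set_valP.
exists (exist _ x (mem_set Ax)); split => // W.
rewrite nbhsE/= => -[W' [[B oB <-] Bx] BW].
apply: (filterS BW); apply: Fx; exact: open_nbhs_nbhs.
Qed.

End weak_topology_facts.

(** * Pairing of L1 classes with tests *)

Section L1_pairing.
Context d (T : measurableType d) (R : realType) (mu : probability T R).
Local Notation L1 := (LspaceType1 mu).
Implicit Types (u v : L1) (phi : T -> R).

Lemma L1_measurable u : measurable_fun setT (u : T -> R).
Proof. exact: (measurable_funPT (L1_repr u)). Qed.

Lemma L1_integrable u : mu.-integrable setT (EFin \o (u : T -> R)).
Proof.
apply/integrableP; split; first by apply/measurable_EFinP; exact: L1_measurable.
have : finite_norm mu 1 (u : T -> R) by exact: Lebesgue_finite.
by rewrite /finite_norm Lnorm1.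
Qed.

Lemma ae_eq_Rintegral (f g : T -> R) :
  measurable_fun setT f -> measurable_fun setT g ->
  f = g %[ae mu] -> \int[mu]_w f w = \int[mu]_w g w.
Proof.
move=> mf mg fg; congr fine; apply: ae_eq_integral => //.
- exact/measurable_EFinP.
- exact/measurable_EFinP.
- by apply: filterS fg => w fgw _; rewrite fgw.
Qed.

Lemma L1_normE u : `|u| = \int[mu]_w `|u w|.
Proof. by rewrite -[LHS]/(L1_norm u) /L1_norm Lnorm1. Qed.

Lemma L1_scaleDE (a : R) u v :
  (a *: u + v : T -> R) = (fun w => a * u w + v w) %[ae mu].
Proof.
rewrite -[a *: u + v]/(L1_class (L1_repr (L1_class (a *: L1_repr u)) + L1_repr v)).
apply: ae_eq_trans (L1_classE _) _.
apply: filterS (L1_classE (a *: L1_repr u)) => w /= H wT.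
by rewrite [LHS](f_equal (fun x => x + v w) (H wT)).
Qed.

(** The proof [tphi] is an argument so that the map can carry a linear structure; with values in
    [R^o] it becomes an element of [continuous_dual]. *)
Definition L1_pairing phi (tphi : tests phi) (u : L1) : R^o :=
  \int[mu]_w (phi w * u w).

Let L1_pairing_linear phi (tphi : tests phi) : linear (L1_pairing tphi).
Proof.
move=> a u v; rewrite /L1_pairing.
rewrite -[RHS]/(a * \int[mu]_w (phi w * u w) + \int[mu]_w (phi w * v w)).
have [mphi _] := tphi.
rewrite (@ae_eq_Rintegral _ (fun w => a * (phi w * u w) + phi w * v w)).
- have iu := integrableM_test tphi (L1_integrable u).
  have iv := integrableM_test tphi (L1_integrable v).
  by rewrite RintegralD ?RintegralZl//; exact: integrableZR.
- by apply: measurable_funM => //; exact: L1_measurable.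
- apply: measurable_funD; [apply: measurable_funM|] => //;
  by apply: measurable_funM => //; exact: L1_measurable.
- by apply: filterS (L1_scaleDE a u v) => w /= H wT; rewrite H//; ring.
Qed.

HB.instance Definition _ phi (tphi : tests phi) :=
  @GRing.isLinear.Build R L1 R^o *:%R (L1_pairing tphi) (L1_pairing_linear tphi).

Lemma L1_pairing_continuous phi (tphi : tests phi) : continuous (L1_pairing tphi).
Proof.
apply: bounded_linear_continuous; apply/linear_boundedP.
exists 1; split; first exact: num_real.
move=> M M1 u; apply: (@le_trans _ _ `|u|); last by rewrite ler_peMl// ltW.
by rewrite L1_normE; apply: normr_test_integral_le => //; exact: L1_integrable.
Qed.

Lemma L1_pairing_weak_continuous phi : tests phi ->
  continuous (fun u : weak L1 => \int[mu]_w (phi w * (u : L1) w)).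
Proof.
move=> tphi; pose f : continuous_dual L1 :=
  exist (fun f : {linear L1 -> R^o} => continuous f)
    (L1_pairing tphi) (@L1_pairing_continuous _ tphi).
exact: (@weak_dual_continuous _ _ f).
Qed.

Lemma tests_indic (A : set T) : measurable A -> tests (\1_A : T -> R).
Proof.
move=> mA; split=> [|w]; first exact: measurable_indic.
by rewrite indicE; case: (_ \in _); rewrite lexx ler01.
Qed.

Lemma L1_pairing_eq u v :
  (forall phi, tests phi ->
    \int[mu]_w (phi w * u w) = \int[mu]_w (phi w * v w)) ->
  u = v.
Proof.
move=> H; apply/L1_eqP.
suff : ae_eq mu setT (EFin \o (u : T -> R)) (EFin \o (v : T -> R)).
  by apply: filterS => w /= uv wT; exact: EFin_inj (uv wT).
apply: integral_ae_eq => //; first exact: L1_integrable.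
  by apply/measurable_EFinP; exact: L1_measurable.
move=> A _ mA.
have E (f : L1) :
    (\int[mu]_(w in A) (f w)%:E = (\int[mu]_w (\1_A w * f w))%:E)%E.
  rewrite /Rintegral fineK; last first.
    apply: integrable_fin_num => //.
    exact: integrableM_test (tests_indic mA) (L1_integrable f).
  rewrite [LHS]integral_mkcond; apply: eq_integral => w _.
  by rewrite patchE indicE; case: ifPn; rewrite ?mul1r ?mul0r.
by rewrite /comp !E H//; exact: tests_indic.
Qed.

(** Pairings with tests are weakly continuous and, as indicators are tests, they separate classes.
    The Riesz construction uses this to obtain normality. *)
Lemma weak_L1_subset_hausdorff (A : set (weak L1)) : hausdorff_space (A : Type).
Proof.
move=> x y xy; apply: val_inj; apply: L1_pairing_eq => phi tphi.
pose f (z : A) := \int[mu]_w (phi w * (set_val z : L1) w).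
have cf : continuous f.
  move=> z; apply: (@continuous_comp A (weak L1) R set_val
    (fun u => \int[mu]_w (phi w * (u : L1) w))).
    exact: initial_continuous.
  exact: L1_pairing_weak_continuous.
rewrite -[LHS]/(f x) -[RHS]/(f y); apply: Rhausdorff => B C Bx Cy.
have [z [Bz Cz]] := xy _ _ (cf x _ Bx) (cf y _ Cy).
by exists (f z).
Qed.

Lemma expectation_density (p : probability T R) phi : p `<< mu -> tests phi ->
  ('E_p[phi] = (\int[mu]_w (phi w * density mu p w))%:E)%E.
Proof.
move=> pmu tphi; have [mphi phi01] := tphi.
have iphi : p.-integrable setT (EFin \o phi).
  apply: measurable_bounded_integrable => //.
  - by rewrite [X in (X < _)%E]probability_setT ltry.
  - exists 1; split; [exact: num_real|move=> x x1 w _ /=].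
    have /andP[p0 p1] := phi01 w.
    by rewrite ger0_norm// (le_trans p1)// ltW.
have mh : measurable_fun setT (Radon_Nikodym (charge_of_finite_measure p) mu).
  by apply: (measurable_int mu); exact: Radon_Nikodym_integrable.
rewrite unlock -(Radon_Nikodym_change_of_variables pmu)//.
have ipd := integrableM_test tphi (L1_integrable (density mu p)).
rewrite /Rintegral fineK; last exact: integrable_fin_num ipd.
apply: ae_eq_integral => //.
- by apply: emeasurable_funM => //; exact/measurable_EFinP.
- exact: measurable_int ipd.
- by apply: filterS (densityE pmu) => w /= H wT; rewrite EFinM H.
Qed.

End L1_pairing.

(** * The saddle point *)

Section saddle.
Context d (T : measurableType d) (R : realType) (mu : probability T R).
Local Notation L1 := (LspaceType1 mu).
Local Notation ip phi u := (\int[mu]_w (phi w * (u : L1) w))%R.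

Lemma test_cst (c : R) : 0 <= c <= 1 -> @tests d T R (fun=> c).
Proof. by move=> c01; split. Qed.

Lemma ip_density_itv (p : probability T R) phi : p `<< mu -> tests phi ->
  0 <= ip phi (density mu p) <= 1.
Proof.
move=> pmu tphi; have [mphi phi01] := tphi.
suff : (0 <= (ip phi (density mu p))%:E <= 1)%E by rewrite !lee_fin.
rewrite -expectation_density// unlock; apply/andP; split.
  by apply: integral_ge0 => w _; rewrite lee_fin; have /andP[] := phi01 w.
have <- : (\int[p]_w cst 1 w = 1)%E.
  by rewrite integral_cst// mul1e; exact: probability_setT.
apply: ge0_le_integral => //.
- by move=> w _; rewrite lee_fin; have /andP[] := phi01 w.
- exact/measurable_EFinP.
- by move=> w _; rewrite lee_fin; have /andP[] := phi01 w.
Qed.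

Lemma ip_density1 (p : probability T R) : p `<< mu ->
  ip (fun=> 1) (density mu p) = 1.
Proof.
move=> pmu; apply: EFin_inj; rewrite -expectation_density//.
  by rewrite unlock integral_cst// mul1e; exact: probability_setT.
by apply: test_cst; rewrite ler01 lexx.
Qed.

Lemma ip_sum (phi : T -> R) (J : Type) (f : J -> L1) (c : R) (s : seq J) :
  tests phi ->
  ip phi (c *: \sum_(j <- s) f j) = c * \sum_(j <- s) ip phi (f j).
Proof.
move=> tphi; rewrite -[LHS]/(L1_pairing tphi _) linearZ linear_sum.
by [].
Qed.

Lemma convex_tests n (x : 'I_n -> R) (phi : 'I_n -> T -> R) :
  (forall i, 0 <= x i) -> \sum_i x i = 1 -> (forall i, tests (phi i)) ->
  tests (fun w => \sum_i x i * phi i w).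
Proof.
move=> x0 x1 tphi; split=> [|w].
  apply/measurable_EFinP.
  rewrite (_ : EFin \o _ = fun w => (\sum_i (x i * phi i w)%:E)%E); last first.
    by apply/funext => w; rewrite /= sumEFin.
  apply: emeasurable_sum => i; apply/measurable_EFinP.
  by apply: measurable_funM => //; have [] := tphi i.
have H i : 0 <= phi i w <= 1 by have [_] := tphi i; apply.
apply/andP; split.
  by apply: sumr_ge0 => i _; rewrite mulr_ge0//; have /andP[] := H i.
rewrite -x1; apply: ler_sum => i _.
by rewrite ler_piMr//; have /andP[] := H i.
Qed.

Lemma ip_convex n (x : 'I_n -> R) (phi : 'I_n -> T -> R) (u : L1) :
  (forall i, tests (phi i)) ->
  ip (fun w => \sum_i x i * phi i w) u = \sum_i x i * ip (phi i) u.
Proof.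
move=> tphi; have ip_i i := integrableM_test (tphi i) (L1_integrable u).
under eq_Rintegral do rewrite mulr_suml.
rewrite Rintegral_sum => [|i]; last first.
  by under eq_fun do rewrite -mulrA; exact: integrableZR.
apply: eq_bigr => i _; under eq_Rintegral do rewrite -mulrA.
by rewrite RintegralZl.
Qed.

Context (C : set L1) (K : Type) (k0 : K) (v : K -> L1).
Hypotheses (C0 : C !=set0) (C_convex : convex_set C).
Hypotheses (C_itv : forall u phi, C u -> tests phi -> 0 <= ip phi u <= 1).
Hypotheses (v_itv : forall k phi, tests phi -> 0 <= ip phi (v k) <= 1).
Variables (alpha c : R).
Hypotheses (alpha01 : 0 <= alpha <= 1) (c0 : 0 <= c).

Local Notation test := {phi : T -> R | tests phi}.

(** Integral of [f] against a finitely supported measure of mass at most [c]: each entry of [s] puts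
    mass [c] at its point or, if its bit is false, no mass, and the entries are averaged. *)
Definition weighted_average (s : seq (K * bool)) (f : K -> R) : R :=
  (\sum_(y <- s) y.2%:R * c * f y.1) / (size s)%:R.

(** Approximate minimax with the tests of [l] as rows, and as columns an element of [C], a point of
    [K] and a bit. By convexity the mixed row is a test and the averaged column has its first
    component in [C]. Occurrence of [psi] in [l] is stated by splitting the list, which yields its
    row index. *)
Lemma finite_game (l : seq test) (e : R) : 0 < e ->
  exists (phi : test) (u : L1) (s : seq (K * bool)), C u /\
    forall psi a b, l = a ++ psi :: b -> forall u' k (t : bool), C u' ->
      ip (sval psi) u +
        weighted_average s (fun k => alpha - ip (sval psi) (v k)) <=
      ip (sval phi) u' + t%:R * c * (alpha - ip (sval phi) (v k)) + e.
Proof.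
move=> e0; have [u0 Cu0] := C0.
have t0 : @tests d T R (fun=> 0) by apply: test_cst; rewrite lexx ler01.
(* The zero test makes the set of rows nonempty even for an empty [l]; it shifts the index of [psi]
   to [(size a).+1]. *)
pose l' := exist _ _ t0 :: l.
pose phi (i : 'I_(size l).+1) := sval (nth (exist _ _ t0) l' i).
have tphi i : tests (phi i) by exact: svalP.
pose J := ({u : L1 | C u} * (K * bool))%type.
pose A i (j : J) :=
  ip (phi i) (sval j.1) + j.2.2%:R * c * (alpha - ip (phi i) (v j.2.1)).
have AC i j : `|A i j| <= 1 + c.
  rewrite (le_trans (ler_normD _ _))// lerD//.
    by have /andP[h0 h1] := C_itv (svalP j.1) (tphi i); rewrite ger0_norm.
  have /andP[h0 h1] := v_itv j.2.1 (tphi i); have /andP[a0 a1] := alpha01.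
  have h : `|alpha - ip (phi i) (v j.2.1)| <= 1.
    by rewrite ler_norml; apply/andP; split; lra.
  rewrite !normrM (ger0_norm c0).
  case: j.2.2; rewrite ?normr1 ?normr0 ?mul0r// mul1r.
  by rewrite ler_piMr.
have [x [s [x0 x1 s0 xs]]] := approx_minimax AC (exist _ u0 Cu0, (k0, true)) e0.
exists (exist _ _ (convex_tests x0 x1 tphi)).
exists ((size s)%:R^-1 *: \sum_(j <- s) sval j.1), [seq j.2 | j <- s]; split.
  by apply: convex_set_average => // j; exact: svalP.
move=> psi a b lE u' k t Cu'.
have ai : ((size a).+1 < (size l).+1)%N.
  by rewrite lE size_cat/= addnS !ltnS leq_addr.
have := xs (Ordinal ai) (exist _ u' Cu', (k, t)).
have phiE : phi (Ordinal ai) = sval psi.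
  by rewrite /phi /l' /= lE nth_cat ltnn subnn.
rewrite /A /= phiE !ip_convex//.
under [X in _ <= X + _]eq_bigr do rewrite mulrDr.
rewrite ip_sum; last exact: svalP.
rewrite /weighted_average size_map big_map !big_split/= mulrDl mulrC.
congr (_ <= _ + _ + _).
rewrite mulrBr mulr_sumr; under eq_bigr do rewrite mulrBr mulrBr.
rewrite sumrB; congr (_ - _).
  by rewrite -mulr_suml x1 mul1r.
by apply: eq_bigr => i _; rewrite mulrCA.
Qed.

Local Notation contains l := [set l' : seq test | exists a b, l' = a ++ l ++ b].

(** The concatenation of two lists contains both as blocks, so the sets of lists containing a given
    block form a filter base. *)
Lemma seq_ultrafilter : exists U : set_system (seq test),
  UltraFilter U /\ forall l, U (contains l).
Proof.
pose F := filter_from [set: seq test] (fun l => contains l).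
have FF : ProperFilter F.
  apply: filter_from_proper => [|l _]; last by exists l, [::], [::]; rewrite cats0.
  apply: filter_from_filter; first by exists [::].
  move=> l1 l2 _ _; exists (l1 ++ l2) => // _ [a [b ->]]; split.
    by exists a, (l2 ++ b); rewrite !catA.
  by exists (a ++ l1), b; rewrite !catA.
have [U [uU FU]] := ultraFilterLemma FF.
by exists U; split => // l; apply: FU; exists l.
Qed.

End saddle.

(** * Passage from finite games to all tests *)

Section saddle_limit.
Context d (T : measurableType d) (R : realType) (mu : probability T R).
Local Notation L1 := (LspaceType1 mu).
Local Notation ip phi u := (\int[mu]_w (phi w * (u : L1) w))%R.
Context (K : ptopologicalType) (v : K -> L1) (C : set L1) (alpha c : R).
Hypotheses (K_hausdorff : hausdorff_space K) (K_compact : compact [set: K]).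
Hypotheses (C0 : C !=set0) (C_convex : convex_set C)
  (C_compact : weakly_compact C).
Hypotheses (C_itv : forall u phi, C u -> tests phi -> 0 <= ip phi u <= 1).
Hypotheses (v_itv : forall k phi, tests phi -> 0 <= ip phi (v k) <= 1)
  (v_continuous : forall phi, tests phi -> continuous (fun k => ip phi (v k) : R)).
Hypotheses (alpha01 : 0 <= alpha <= 1) (c0 : 0 <= c).

Let avg := @weighted_average R K c.

Let avg_le s f (M : R) : (forall k, `|f k| <= M) -> `|avg s f| <= c * M.
Proof.
move=> fM; rewrite /avg /weighted_average normrM.
have M0 : 0 <= M := le_trans (normr_ge0 _) (fM point).
have [->|s0] := eqVneq s [::].
  by rewrite big_nil normr0 mul0r mulr_ge0.
have n0 : 0 < (size s)%:R :> R by rewrite ltr0n lt0n size_eq0.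
rewrite [`|_^-1|]ger0_norm ?invr_ge0 ?ler0n// ler_pdivrMr//.
rewrite (le_trans (ler_norm_sum _ _ _))// -sum1_size natr_sum mulr_sumr.
apply: ler_sum => y _; rewrite mulr1 !normrM (ger0_norm c0).
rewrite ler_pM ?mulr_ge0//; case: y.2; rewrite ?normr1 ?normr0 ?mul1r ?mul0r//.
Qed.

Let avgD s f g : avg s (fun k => f k + g k) = avg s f + avg s g.
Proof.
rewrite /avg /weighted_average -mulrDl -big_split/=; congr (_ / _).
by apply: eq_bigr => y _; rewrite mulrDr.
Qed.

Let avgZ s a f : avg s (fun k => a * f k) = a * avg s f.
Proof.
rewrite /avg /weighted_average mulrA mulr_sumr; congr (_ / _).
by apply: eq_bigr => y _; rewrite mulrCA.
Qed.

Let avg_ge0 s f : (forall k, 0 <= f k) -> 0 <= avg s f.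
Proof.
move=> f0; rewrite divr_ge0// sumr_ge0// => y _.
by rewrite !mulr_ge0.
Qed.

(** A fixed [psi] occurs in [U]-almost every list, so the finite inequalities survive in the limit.
    On the right the multiplier is 0 or a point mass [c], according to [t]. *)
Lemma saddle_point : exists (phi : T -> R) (u : L1)
    (la : {finite_measure set (g_sigma_algebraType (@open K)) -> \bar R}),
  [/\ tests phi, C u &
    forall psi u' k (t : bool), tests psi -> C u' ->
      ip psi u + \int[la]_k (alpha - ip psi (v k)) <=
      ip phi u' + t%:R * c * (alpha - ip phi (v k))].
Proof.
have [U [uU Uc]] := @seq_ultrafilter d T R.
have eps0 n : 0 < n.+1%:R^-1 :> R by rewrite invr_gt0.
pose test := {phi : T -> R | tests phi}.
have /choice[x xP] : forall l : seq test,
  exists x : test * (L1 * seq (K * bool)),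
    C x.2.1 /\ forall psi a b, l = a ++ psi :: b ->
    forall u' k (t : bool), C u' ->
      ip (sval psi) x.2.1 + avg x.2.2 (fun k => alpha - ip (sval psi) (v k)) <=
      ip (sval x.1) u' + t%:R * c * (alpha - ip (sval x.1) (v k)) +
        (size l).+1%:R^-1.
  move=> l; have [phi [u [s H]]] := finite_game point C0 C_convex C_itv v_itv
    alpha01 c0 l (eps0 (size l)).
  by exists (phi, (u, s)).
have [phi [tphi cphi]] := tests_ultra_compact mu uU (fun l => svalP (x l).1).
have [u Cu cu] := ultra_compact_cvg uU C_compact (fun l => (xP l).1).
(* Averages of a bounded function are bounded uniformly in the list, so the limit exists for every
   bounded function, continuous or not. *)
pose Lam f := lim ((fun l => avg (x l).2.2 f) @ U) : R.
have Lam_cvg f : (exists M : R, forall z, `|f z| <= M) ->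
    (fun l => avg (x l).2.2 f) @ U --> Lam f.
  move=> [M fM]; apply: (ultra_bounded_cvg uU (M := c * M)) => l.
  exact: avg_le.
have [|||la laE] := @riesz_representation R K Lam K_hausdorff K_compact.
- move=> f g bf bg; apply/cvg_lim => //.
  rewrite (_ : (fun l => _) = (fun l => avg (x l).2.2 f + avg (x l).2.2 g)).
    by apply: cvgD; exact: Lam_cvg.
  by apply/funext => l; exact: avgD.
- move=> a f bf; apply/cvg_lim => //.
  rewrite (_ : (fun l => _) = (fun l => a * avg (x l).2.2 f)).
    by apply: cvgM; [exact: cvg_cst|exact: Lam_cvg].
  by apply/funext => l; exact: avgZ.
- move=> f bf f0; apply: limr_ge; first exact: Lam_cvg.
  by apply: nearW => l; exact: avg_ge0.
exists phi, u, la; split => // psi u' k t tpsi Cu'.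
have ps_bdd : exists M : R, forall k, `|alpha - ip psi (v k)| <= M.
  exists 1 => k'; have /andP[h0 h1] := v_itv k' tpsi.
  have /andP[a0 a1] := alpha01.
  by rewrite ler_norml; apply/andP; split; lra.
have ps_cont : continuous (fun k => alpha - ip psi (v k) : R).
  by move=> z; apply: cvgB; [exact: cvg_cst|exact: v_continuous].
have -> : \int[la]_k (alpha - ip psi (v k)) = Lam (fun k => alpha - ip psi (v k)).
  by rewrite /Rintegral laE.
have lhs : (fun l => ip psi (x l).2.1 +
      avg (x l).2.2 (fun k => alpha - ip psi (v k))) @ U
    --> ip psi u + Lam (fun k => alpha - ip psi (v k)).
  apply: cvgD; last exact: Lam_cvg.
  apply: (@cvg_comp _ _ _ (fun l => (x l).2.1 : weak L1)
    (fun u : weak L1 => ip psi u) _ _ _ cu).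
  exact: (L1_pairing_weak_continuous tpsi).
have rhs : (fun l => ip (sval (x l).1) u' +
      t%:R * c * (alpha - ip (sval (x l).1) (v k))) @ U
    --> ip phi u' + t%:R * c * (alpha - ip phi (v k)).
  apply: cvgD; first exact: cphi (L1_integrable u').
  apply: cvgM; first exact: cvg_cst.
  apply: cvgB; first exact: cvg_cst.
  exact: cphi (L1_integrable (v k)).
apply/ler_addgt0Pr => e e0.
have cst_e : (fun=> e) @ U --> e by exact: cvg_cst.
have UF : Filter U by exact: filter_filter.
have gap := cvgB (cvgD rhs cst_e) lhs.
rewrite -subr_ge0 -(cvg_lim _ (gap UF UF))//; apply: limr_ge.
  exact: cvgP (gap UF UF).
pose p : test := exist _ psi tpsi.
(* The block makes [psi] a row of the game and, by its length alone, forces the precision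
   [1 / (size l + 1)] below [e]. *)
apply: filterS (Uc (nseq (Num.truncn e^-1) p ++ [:: p])) => _ [a [b ->]].
set l := a ++ _; have lE : l = (a ++ nseq (Num.truncn e^-1) p) ++ p :: b.
  by rewrite /l !catA -catA.
have := (xP l).2 p _ _ lE u' k t Cu'.
have : (size l).+1%:R^-1 <= e.
  rewrite -[leRHS]invrK lef_pV2 ?posrE ?invr_gt0//; apply: ltW.
  apply: lt_le_trans (truncnS_gt e^-1) _.
  rewrite ler_nat ltnS lE !size_cat size_nseq.
  by rewrite -addnA addnCA leq_addr.
rewrite /= subr_ge0 => le_e /le_trans; apply.
by rewrite lerD2l.
Qed.

End saddle_limit.

(** * Duality *)

Lemma mulr_le_pos_part (R : realDomainType) (p x : R) :
  0 <= p <= 1 -> p * x <= Num.max x 0.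
Proof. by move=> /andP[p0 p1]; have [h|h] := leP x 0; nra. Qed.

(** Splits the equality case of weak duality into the two complementary slackness relations. *)
Lemma addr_le_eq (R : realDomainType) (x y x' y' : R) :
  x <= x' -> y <= y' -> x + y = x' + y' -> x = x' /\ y = y'.
Proof. by move=> xx' yy' e; split; lra. Qed.

(** * Mixtures of densities and weak duality *)

Section mixture_facts.
Context d (T : measurableType d) (R : realType) (mu : probability T R).
Local Notation L1 := (LspaceType1 mu).
Local Notation ip phi u := (\int[mu]_w (phi w * (u : L1) w))%R.
Context (P : set (probability T R)) (P0 : P !=set0).
Hypothesis P_mu : forall p, P p -> p `<< mu.
Variable Z : ZP mu P0 -> T -> R.
Hypothesis Z_versions : versions Z.
Implicit Types (z : ZP mu P0) (phi psi : T -> R).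

Definition class_of_point z : L1 := set_val z.
Local Notation cl := class_of_point.
Local Notation K :=
  (@pointed_subset (weak L1) (densities mu P) (densities_neq0 mu P0)).

Lemma class_of_pointP z : exists2 p, P p & cl z = density mu p.
Proof. by have [p Pp pz] := set_valP z; exists p. Qed.

Lemma class_of_point_surj p : P p -> exists z, cl z = density mu p.
Proof.
move=> Pp; have dp : densities mu P (density mu p) by exists p.
by exists (exist _ (density mu p) (mem_set dp)).
Qed.

Lemma ip_point_itv z phi : tests phi -> 0 <= ip phi (cl z) <= 1.
Proof.
move=> tphi; have [p Pp ->] := class_of_pointP z.
by apply: ip_density_itv; [exact: P_mu|].
Qed.

Lemma ip_point1 z : ip (fun=> 1) (cl z) = 1.
Proof.
by have [p Pp ->] := class_of_pointP z; apply: ip_density1; exact: P_mu.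
Qed.

Lemma ip_point_continuous phi : tests phi ->
  continuous ((fun z => ip phi (cl z)) : K -> R).
Proof.
move=> tphi z.
apply: (@continuous_comp K (weak L1) R set_val (fun u => ip phi u)).
  exact: (@initial_continuous (densities mu P) (weak L1) set_val).
exact: L1_pairing_weak_continuous.
Qed.

Lemma ip_point_version phi z : tests phi ->
  (\int[mu]_w (phi w * Z z w)%:E = (ip phi (cl z))%:E)%E.
Proof.
move=> tphi; have [_ Zae Zm] := Z_versions; have [mphi _] := tphi.
have iz := integrableM_test tphi (L1_integrable (cl z)).
rewrite /Rintegral fineK; last exact: integrable_fin_num iz.
apply: ae_eq_integral => //.
- apply/measurable_EFinP; apply: measurable_funM => //.
  exact: (measurableT_comp Zm (measurable_pair2 z)).
- exact: measurable_int iz.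
- by apply: filterS (Zae z) => w /= H wT; rewrite H.
Qed.

Variable la : {finite_measure set ZP mu P0 -> \bar R}.

Lemma ip_point_integrable phi : tests phi ->
  la.-integrable setT (EFin \o (fun z => ip phi (cl z))).
Proof.
move=> tphi; apply: measurable_bounded_integrable => //.
- by rewrite -ge0_fin_numE//; exact: fin_num_measure.
- exact: (continuous_open_measurable (ip_point_continuous tphi)).
- exists 1; split; [exact: num_real|move=> x x1 z _ /=].
  have /andP[h0 h1] := ip_point_itv z tphi.
  by rewrite ger0_norm// (le_trans h1)// ltW.
Qed.

Lemma mixture_ge0 w : (0 <= mixture Z la w)%E.
Proof.
by apply: integral_ge0 => z _; rewrite lee_fin; have [] := Z_versions.
Qed.

Lemma mixture_measurable : measurable_fun setT (mixture Z la).
Proof.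
have [Z0 _ Zm] := Z_versions.
apply: (@measurable_fun_fubini_tonelli_F _ _ _ _ _ la
  (fun wz => (Z wz.2 wz.1)%:E)).
  exact/measurable_EFinP.
by move=> wz; rewrite lee_fin.
Qed.

(** Tonelli's theorem, by joint measurability of the versions. *)
Lemma integral_test_mixture phi : tests phi ->
  (\int[mu]_w ((phi w)%:E * mixture Z la w) = \int[la]_z (ip phi (cl z))%:E)%E.
Proof.
move=> tphi; have [Z0 _ Zm] := Z_versions; have [mphi phi01] := tphi.
have mf : measurable_fun setT
    (fun wz : T * ZP mu P0 => (phi wz.1 * Z wz.2 wz.1)%:E).
  apply/measurable_EFinP; apply: measurable_funM => //.
  exact: measurableT_comp.
under [RHS]eq_integral do rewrite -ip_point_version//.
rewrite -(fubini_tonelli _ mf); last first.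
  by move=> [w z]; rewrite lee_fin mulr_ge0//; have /andP[] := phi01 w.
apply: eq_integral => w _; under [RHS]eq_integral do rewrite EFinM /=.
rewrite ge0_integralZl_EFin//.
- by move=> z _; rewrite lee_fin.
- by apply/measurable_EFinP; exact: (measurableT_comp Zm (measurable_pair1 w)).
- by have /andP[] := phi01 w.
Qed.

(** The mixture has integral [la setT], hence is infinite at most on a null set, where [fine]
    replaces it by 0. *)
Definition mixtureR w : R := fine (mixture Z la w).

Lemma integral_mixture : (\int[mu]_w mixture Z la w = la setT)%E.
Proof.
have t1 : @tests d T R (fun=> 1) by apply: test_cst; rewrite ler01 lexx.
have := integral_test_mixture t1.
under eq_integral do rewrite mul1e.
move=> ->; under eq_integral do rewrite ip_point1.
by rewrite integral_cst// mul1e.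
Qed.

Lemma mixture_integrable : mu.-integrable setT (mixture Z la).
Proof.
apply/integrableP; split; first exact: mixture_measurable.
under eq_integral do rewrite gee0_abs ?mixture_ge0//.
by rewrite integral_mixture -ge0_fin_numE//; exact: fin_num_measure.
Qed.

Lemma mixture_fin : {ae mu, forall w, mixture Z la w = (mixtureR w)%:E}.
Proof.
apply: filterS (integrable_ae measurableT mixture_integrable) => w.
by move=> /(_ Logic.I) fw; rewrite fineK.
Qed.

Lemma mixtureR_measurable : measurable_fun setT mixtureR.
Proof. exact: measurableT_comp mixture_measurable. Qed.

Lemma mixtureR_integrable : mu.-integrable setT (EFin \o mixtureR).
Proof.
apply: (le_integrable _ _ _ mixture_integrable) => //.
  by apply/measurable_EFinP; exact: mixtureR_measurable.
move=> w _ /=; rewrite /mixtureR; have := mixture_ge0 w.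
by case: (mixture Z la w) => //= _; rewrite ?normr0 ?leey.
Qed.

Lemma test_mixtureR phi : tests phi ->
  \int[mu]_w (phi w * mixtureR w) = \int[la]_z ip phi (cl z).
Proof.
move=> tphi; congr fine; rewrite -integral_test_mixture//.
have [mphi _] := tphi; apply: ae_eq_integral; first exact: measurableT.
- apply/measurable_EFinP; apply: measurable_funM => //.
  exact: mixtureR_measurable.
- by apply: emeasurable_funM; [exact/measurable_EFinP|exact: mixture_measurable].
- by apply: filterS mixture_fin => w H _; rewrite EFinM H.
Qed.

Definition dual_valueR (alpha : R) (u : L1) : R :=
  \int[mu]_w Num.max (u w - mixtureR w) 0 + alpha * fine (la setT).

Lemma density_mixture_integrable (u : L1) :
  mu.-integrable setT (EFin \o (fun w => u w - mixtureR w)).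
Proof. exact: integrableBR (L1_integrable u) mixtureR_integrable. Qed.

Lemma density_mixture_pos_integrable (u : L1) :
  mu.-integrable setT (EFin \o (fun w => Num.max (u w - mixtureR w) 0)).
Proof.
have iu := density_mixture_integrable u.
apply: (le_integrable _ _ _ iu) => //.
  apply/measurable_EFinP; apply: measurable_maxr => //.
  by apply/measurable_EFinP; exact: measurable_int iu.
move=> w _ /=; rewrite lee_fin ger0_norm ?le_max ?lexx ?orbT//.
by rewrite ge_max ler_norm normr_ge0.
Qed.

Lemma dual_valueE (alpha : R) (q : probability T R) :
  (dual_value Z alpha q la = (dual_valueR alpha (density mu q))%:E)%E.
Proof.
rewrite /dual_value /dual_valueR EFinD; congr (_ + _)%E; last first.
  by rewrite EFinM fineK//; exact: fin_num_measure.
rewrite /Rintegral fineK; last first.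
  exact: integrable_fin_num (density_mixture_pos_integrable _).
apply: ae_eq_integral => //.
- apply: measurable_funepos.
  apply: emeasurable_funB; last exact: mixture_measurable.
  by apply/measurable_EFinP; exact: L1_measurable.
- exact: measurable_int (density_mixture_pos_integrable _).
- by apply: filterS mixture_fin => w H _; rewrite funeposE H -EFinB EFin_max.
Qed.

Lemma ip_mixture_split phi (u : L1) : tests phi ->
  ip phi u = \int[mu]_w (phi w * (u w - mixtureR w)) + \int[la]_z ip phi (cl z).
Proof.
move=> tphi; rewrite -test_mixtureR// -RintegralD//.
- by apply: eq_Rintegral => w _; ring.
- exact: integrableM_test tphi (density_mixture_integrable u).
- exact: integrableM_test tphi mixtureR_integrable.
Qed.

Lemma test_excess_le phi (u : L1) : tests phi ->
  \int[mu]_w (phi w * (u w - mixtureR w)) <=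
    \int[mu]_w Num.max (u w - mixtureR w) 0.
Proof.
move=> tphi; apply: le_Rintegral => //.
- exact: integrableM_test tphi (density_mixture_integrable u).
- exact: density_mixture_pos_integrable.
- by move=> w _; apply: mulr_le_pos_part; exact: tphi.2.
Qed.

Lemma Rintegral_la_le phi (s : R) : tests phi ->
  (forall z, ip phi (cl z) <= s) ->
  \int[la]_z ip phi (cl z) <= s * fine (la setT).
Proof.
move=> tphi ips; rewrite -Rintegral_cst//; apply: le_Rintegral => //.
- exact: ip_point_integrable.
- exact: finite_measure_integrable_cst.
Qed.

(** After adding and subtracting the mixture, the excess of [u] is bounded by its positive part and
    the remaining pairing by [alpha] times the mass of [la]. *)
Lemma weak_duality (alpha : R) phi (u : L1) : tests phi ->
  (forall z, ip phi (cl z) <= alpha) -> ip phi u <= dual_valueR alpha u.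
Proof.
move=> tphi ipa; rewrite ip_mixture_split// lerD//; first exact: test_excess_le.
exact: Rintegral_la_le.
Qed.

Lemma Rintegral_la_sub (alpha : R) phi : tests phi ->
  \int[la]_z (alpha - ip phi (cl z)) =
    alpha * fine (la setT) - \int[la]_z ip phi (cl z).
Proof.
move=> tphi; rewrite RintegralB//; last exact: ip_point_integrable.
- by rewrite Rintegral_cst.
- exact: finite_measure_integrable_cst.
Qed.

(* The test rejecting on [mixtureR < u] maximizes the Lagrangian. *)
Lemma dual_valueR_attained (alpha : R) (u : L1) : exists phi, tests phi /\
  dual_valueR alpha u = ip phi u + \int[la]_z (alpha - ip phi (cl z)).
Proof.
pose B := [set w | mixtureR w < u w].
have mB : measurable B.
  rewrite (_ : B = setT `&` (fun w => u w - mixtureR w) @^-1` `]0, +oo[).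
    apply: (measurable_funB (L1_measurable u) mixtureR_measurable) => //.
  rewrite setTI; apply/seteqP.
  by split=> w; rewrite /B /= in_itv/= andbT subr_gt0.
exists \1_B; split; first exact: tests_indic.
have tB := tests_indic R mB.
rewrite (Rintegral_la_sub alpha tB) (ip_mixture_split u tB).
have -> : \int[mu]_w (\1_B w * (u w - mixtureR w)) =
    \int[mu]_w Num.max (u w - mixtureR w) 0.
  apply: eq_Rintegral => w _; rewrite indicE.
  have [wB|wB] := boolP (w \in B).
    by rewrite mul1r max_l// subr_ge0 ltW//; exact: (set_mem wB).
  rewrite mul0r max_r// subr_le0 leNgt; apply/negP => h.
  by move/negP: wB; apply; exact: mem_set.
by rewrite /dual_valueR; ring.
Qed.

End mixture_facts.

(** * Strong duality and complementary slackness *)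

Lemma Rintegral_eq0_ae d (T : measurableType d) (R : realType)
    (mu : {measure set T -> \bar R}) (f : T -> R) :
  mu.-integrable setT (EFin \o f) -> (forall w, 0 <= f w) ->
  \int[mu]_w f w = 0 -> {ae mu, forall w, f w = 0}.
Proof.
move=> fi f0 If; have mf := measurable_int _ fi.
suff : (\int[mu]_w `|(EFin \o f) w| = 0)%E.
  move/(ae_eq_integral_abs mu measurableT mf); apply: filterS => w /= H.
  exact: EFin_inj (H Logic.I).
under eq_integral do rewrite gee0_abs ?lee_fin//.
rewrite -(fineK (integrable_fin_num measurableT fi)).
by rewrite -[fine _]/(\int[mu]_w f w) If.
Qed.

Theorem theorem4p2 (d : measure_display) (T : measurableType d) (R : realType)
    (mu : probability T R) (P Q : set (probability T R))
    (P0 : P !=set0) (Q0 : Q !=set0)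
    (P_mu : forall p, P p -> p `<< mu) (Q_mu : forall q, Q q -> q `<< mu)
    (Z : ZP mu P0 -> T -> R) (Z_versions : versions Z)
    (Q_compact : weakly_compact (densities mu Q))
    (Q_convex : convex_set (densities mu Q))
    (P_compact : weakly_compact (densities mu P))
    (alpha : R) (alpha_gt0 : 0 < alpha) (alpha_lt1 : alpha < 1) :
  exists (phi : T -> R) (q : probability T R)
      (la : {finite_measure set ZP mu P0 -> \bar R}),
    [/\ level_tests P alpha phi /\
        worst_power Q phi =
          ereal_sup [set worst_power Q psi | psi in level_tests P alpha],
        Q q /\
        dual_value Z alpha q la =
          ereal_inf [set dual_value Z alpha q' la' |
            q' in Q & la' in [set: {finite_measure set ZP mu P0 -> \bar R}]],
        {ae mu, forall w,
          ((mixture Z la w < (density mu q w)%:E)%E -> phi w = 1) /\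
          (((density mu q w)%:E < mixture Z la w)%E -> phi w = 0)},
        {ae la, forall z, ('E_mu[phi \* Z z] = alpha%:E)%E} &
        forall psi q', level_tests P alpha psi -> Q q' ->
          ('E_q[psi] <= 'E_q[phi])%E /\ ('E_q[phi] <= 'E_q'[phi])%E].
Proof.
pose cl : ZP mu P0 -> LspaceType1 mu := @class_of_point _ _ _ mu P P0.
pose ip phi (u : LspaceType1 mu) : R := \int[mu]_w (phi w * u w).
have levelP phi : tests phi ->
    level_tests P alpha phi <-> forall z, ip phi (cl z) <= alpha.
  move=> tphi; split=> [[_ phia] z|phia].
    have [p Pp pz] := class_of_pointP z.
    rewrite -lee_fin; apply: le_trans phia; apply: ereal_sup_ubound.
    by exists p => //; rewrite (expectation_density (P_mu _ Pp) tphi) -pz.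
  split=> //; apply: ge_ereal_sup => _ [p Pp <-].
  have [z pz] := @class_of_point_surj _ _ _ mu P P0 p Pp.
  by rewrite (expectation_density (P_mu _ Pp) tphi) lee_fin -pz; exact: phia.
(* Any mass bound above [1 / alpha] would serve for the multipliers. *)
have c0 : 0 < 2 / alpha by rewrite divr_gt0.
have Q_itv u psi : densities mu Q u -> tests psi -> 0 <= ip psi u <= 1.
  by move=> [q Qq <-]; exact: (ip_density_itv (Q_mu _ Qq)).
have P_itv z psi : tests psi -> 0 <= ip psi (cl z) <= 1.
  exact: ip_point_itv.
have alpha01 : 0 <= alpha <= 1 by rewrite !ltW.
have [phi [_ [la [tphi [q Qq <-] saddle]]]] := @saddle_point d T R mu
  (@pointed_subset (weak (LspaceType1 mu)) (densities mu P)
    (densities_neq0 mu P0))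
  cl (densities mu Q) alpha (2 / alpha)
  (@weak_L1_subset_hausdorff _ _ _ _ _) (compact_subset_type P_compact)
  (densities_neq0 mu Q0) Q_convex Q_compact Q_itv P_itv
  (@ip_point_continuous _ _ _ _ _ P0) alpha01 (ltW c0).
set u := density mu q in saddle.
pose m := fine (la setT); have m0 : 0 <= m by exact: fine_ge0.
pose D := dual_valueR Z la alpha u.
have D_le u' z (t : bool) : densities mu Q u' ->
    D <= ip phi u' + t%:R * (2 / alpha) * (alpha - ip phi (cl z)).
  (* The saddle inequality is used at a test that attains the dual value. *)
  move=> Cu'; have [psi [tpsi DE]] :=
    dual_valueR_attained P_mu Z_versions la alpha u.
  by rewrite /D DE; exact: saddle.
have D_leQ u' : densities mu Q u' -> D <= ip phi u'.
  by move=> Cu'; have := D_le _ point false Cu'; rewrite !mul0r addr0.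
have Cu : densities mu Q u by exists q.
have excess_le := test_excess_le P_mu Z_versions la u tphi.
have splitE : ip phi u = \int[mu]_w (phi w * (u w - mixtureR Z la w)) +
    \int[la]_z ip phi (cl z).
  exact: ip_mixture_split.
have DE : D = \int[mu]_w Num.max (u w - mixtureR Z la w) 0 + alpha * m by [].
have m_small : alpha * m <= 1.
  apply: (@le_trans _ _ D); last first.
    by apply: le_trans (D_leQ _ Cu) _; have /andP[] := Q_itv _ _ Cu tphi.
  rewrite DE lerDr; apply: Rintegral_ge0 => w _.
  by rewrite le_max lexx orbT.
(* The duality gap is at most [s * m] where [s] is the largest violation of the
   level, whereas charging a point of violation [s] with mass [c] lowers the
   Lagrangian by [c * s]; as [m < c], there is no violation. *)
have phi_level z : ip phi (cl z) <= alpha.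
  pose S := range (fun z => ip phi (cl z) - alpha).
  have Sub : has_ubound S.
    exists 1 => _ [z' _ <-]; have /andP[_ h] := P_itv z' _ tphi.
    by apply: le_trans h; rewrite gerBl ltW.
  pose s := sup S.
  have le_s z' : ip phi (cl z') - alpha <= s.
    by apply: ub_le_sup => //; exists z'.
  have la_s : \int[la]_z ip phi (cl z) <= (s + alpha) * m.
    by apply: Rintegral_la_le => // z'; rewrite -lerBlDr; exact: le_s.
  have gap : ip phi u - D <= s * m.
    rewrite lerBlDr splitE DE (le_trans (lerD excess_le la_s))//.
    by rewrite mulrDl addrCA.
  have s_le : s <= s * m / (2 / alpha).
    apply: ge_sup; first by exists (ip phi (cl z) - alpha), z.
    move=> _ [z' _ <-]; rewrite ler_pdivlMr//; apply: le_trans gap.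
    have := D_le _ z' true Cu; rewrite mul1r -[alpha - _]opprB mulrN mulrC.
    by rewrite lerBrDr -lerBrDl.
  rewrite leNgt; apply/negP => phiz.
  have s0 : 0 < s by apply: lt_le_trans (le_s z); rewrite subr_gt0.
  (* Cancelling [s] leaves 2 at most [alpha * m], against [m_small]. *)
  move: s_le; rewrite ler_pdivlMr// ler_pM2l// ler_pdivrMr// mulrC.
  by move=> /le_trans/(_ m_small); rewrite (ler_nat _ 2 1).
have ipu_le : ip phi u <= D by exact: weak_duality.
have D_eq : D = ip phi u by apply/eqP; rewrite eq_le ipu_le D_leQ.
have la_le : \int[la]_z ip phi (cl z) <= alpha * m by exact: Rintegral_la_le.
(* Without duality gap, both estimates behind weak duality are equalities for [phi] and [u]. *)
have [excess_eq la_eq] := addr_le_eq excess_le la_le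
  (etrans (esym splitE) (etrans (esym D_eq) DE)).
have level_phi : level_tests P alpha phi by apply/levelP.
have Eq_q q' psi : Q q' -> tests psi ->
    ('E_q'[psi] = (ip psi (density mu q'))%:E)%E.
  by move=> Qq' tpsi; rewrite (expectation_density (Q_mu _ Qq') tpsi).
have saddle_phi psi q' : level_tests P alpha psi -> Q q' ->
    ('E_q[psi] <= 'E_q[phi])%E /\ ('E_q[phi] <= 'E_q'[phi])%E.
  move=> lpsi Qq'; have tpsi := lpsi.1.
  rewrite !Eq_q// !lee_fin -/u -D_eq; split; last by apply: D_leQ; exists q'.
  by apply: weak_duality => //; apply/levelP.
exists phi, q, la; split => //.
- split=> //; apply/eqP; rewrite eq_le; apply/andP; split.
    by apply: ereal_sup_ubound; exists phi.
  apply: ge_ereal_sup => _ [psi lpsi <-].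
  apply: le_ereal_inf_tmp => _ [q' Qq' <-].
  have [h1 h2] := saddle_phi _ _ lpsi Qq'.
  apply: le_trans h2; apply: le_trans h1.
  by apply: ereal_inf_lbound; exists q.
- split=> //; apply/eqP; rewrite eq_le; apply/andP; split.
    apply: le_ereal_inf_tmp => _ [q' Qq' [la' _ <-]].
    (* [D] is at most the power of [phi] at [q'], which weak duality bounds by the dual value at
       [q'] and [la']. *)
    rewrite !(dual_valueE P_mu Z_versions) lee_fin -/u -/D.
    apply: le_trans (D_leQ (density mu q') _) _; first by exists q'.
    exact: weak_duality.
  by apply: ereal_inf_lbound; exists q => //; exists la.
- have gi : mu.-integrable setT (EFin \o (fun w =>
      Num.max (u w - mixtureR Z la w) 0 - phi w * (u w - mixtureR Z la w))).
    apply: integrableBR; first exact: density_mixture_pos_integrable.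
    exact: integrableM_test tphi (density_mixture_integrable _ _ _ _).
  have g0 w : 0 <= Num.max (u w - mixtureR Z la w) 0 -
      phi w * (u w - mixtureR Z la w).
    by rewrite subr_ge0; apply: mulr_le_pos_part; exact: tphi.2.
  have Ig : \int[mu]_w (Num.max (u w - mixtureR Z la w) 0 -
      phi w * (u w - mixtureR Z la w)) = 0.
    rewrite RintegralB//; last 2 first.
    + exact: density_mixture_pos_integrable.
    + exact: integrableM_test tphi (density_mixture_integrable _ _ _ _).
    by rewrite excess_eq subrr.
  (* A nonnegative function with zero integral vanishes almost everywhere. It equals
     [(1 - phi) * (u - mixture)] where [u] exceeds the mixture, and [- phi * (u - mixture)] where it
     is smaller. *)
  have := Rintegral_eq0_ae gi g0 Ig; move: (mixture_fin P_mu Z_versions la).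
  apply: filterS2 => w Mw gw; rewrite Mw !lte_fin -/u; split=> h.
    move: gw; rewrite max_l; last by rewrite subr_ge0 ltW.
    move/eqP; rewrite -{1}[u w - _]mul1r -mulrBl mulf_eq0 !subr_eq0.
    by move=> /orP[/eqP//|]; rewrite gt_eqF.
  move: gw; rewrite max_r; last by rewrite subr_le0 ltW.
  move/eqP; rewrite sub0r oppr_eq0 mulf_eq0 subr_eq0.
  by move=> /orP[/eqP//|]; rewrite lt_eqF.
- have gi : la.-integrable setT (EFin \o (fun z => alpha - ip phi (cl z))).
    exact: (integrableB measurableT
      (finite_measure_integrable_cst la alpha measurableT)
      (ip_point_integrable P_mu la tphi)).
  have g0 z : 0 <= alpha - ip phi (cl z) by rewrite subr_ge0.
  have Ig : \int[la]_z (alpha - ip phi (cl z)) = 0.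
    by rewrite (Rintegral_la_sub P_mu)// la_eq subrr.
  have := Rintegral_eq0_ae gi g0 Ig; apply: filterS => z /eqP.
  rewrite subr_eq0 => /eqP ->; rewrite unlock.
  exact: (ip_point_version Z_versions z tphi).
Qed.
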